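(* Let $F$ be a Finsler function on a connected smooth $2$-dimensional manifold $M$, let $S$ be its geodesic spray, with Jacobi endomorphism $\Phi$, curvature tensor $R$ and horizontal projector $h$, and let $\alpha$ be the semi-basic $1$-form determined by $\Phi=\rho J-\alpha\otimes\mathcal C$. Let $W_1=R-\frac{1}{2(n-1)}\,d_J(\operatorname{Tr}\Phi)\wedge J$ with $n=2$. Then $F$ has constant flag curvature if and only if both of the following conditions hold: (1) $W_1=0$; (2) $d_h\alpha=0$.
   Context: $M$ is a connected smooth $n$-manifold (here $n=2$), $TM$ its tangent bundle with induced coordinates $(x^i,y^i)$, $T_0M$ the tangent bundle with the zero section removed. $\mathcal C=y^i\frac{\partial}{\partial y^i}$ is the Liouville vector field and $J=dx^i\otimes\frac{\partial}{\partial y^i}$ the tangent endomorphism. A Finsler function is a continuous $F:TM\to\mathbb R$, smooth and strictly positive on $T_0M$, with $F(x,\lambda y)=\lambda F(x,y)$ for $\lambda>0$, and such that $g_{ij}=\frac12\frac{\partial^2F^2}{\partial y^i\partial y^j}$ has rank $n$ on $T_0M$. Its geodesic spray is the unique vector field $S=y^i\frac{\partial}{\partial x^i}-2G^i(x,y)\frac{\partial}{\partial y^i}$ on $T_0M$ with $i_S\,dd_JF^2=-dF^2$. For a spray $S$ put $N^i_j=\partial G^i/\partial y^j$ and $\frac{\delta}{\delta x^i}=\frac{\partial}{\partial x^i}-N^j_i\frac{\partial}{\partial y^j}$; the horizontal projector is $h=\frac{\delta}{\delta x^i}\otimes dx^i$. The Jacobi endomorphism is $\Phi=R^i_j\,\frac{\partial}{\partial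 y^i}\otimes dx^j$ with $R^i_j=2\frac{\delta G^i}{\delta x^j}-S(N^i_j)+N^i_kN^k_j$; $\operatorname{Tr}\Phi=R^i_i$ and the Ricci scalar is $\rho=\frac1{n-1}\operatorname{Tr}\Phi$. The curvature tensor is $R=\frac12[h,h]$ (Frölicher–Nijenhuis bracket), i.e. $R=\frac12R^k_{ij}\,dx^i\wedge dx^j\otimes\frac{\partial}{\partial y^k}$ with $R^k_{ij}=\frac{\delta N^k_i}{\delta x^j}-\frac{\delta N^k_j}{\delta x^i}$; it satisfies $i_SR=\Phi$ and $3R=[J,\Phi]$. A spray is isotropic if there is a semi-basic 1-form $\alpha$ on $T_0M$ with $\Phi=\rho J-\alpha\otimes\mathcal C$. Every spray on a $2$-dimensional manifold is isotropic, and $\alpha$ is then unique. For a function $f$ on $T_0M$, $d_Jf=\frac{\partial f}{\partial y^i}dx^i$. For a semi-basic 1-form $\beta=\beta_i\,dx^i$: $\beta\wedge J=\beta_i\,dx^i\wedge dx^j\otimes\frac{\partial}{\partial y^j}$ and $d_h\beta=\frac{\delta\beta_j}{\delta x^i}dx^i\wedge dx^j$. $F$ has constant flag curvature if there is a constant $\kappa$ with $\Phi=\kappa F^2J-\kappa F\,d_JF\otimes\mathcal C$. *)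

(* Defs.v *)
From HB Require Import structures.
From mathcomp Require Import all_boot all_order all_algebra.
From mathcomp Require Import all_classical all_reals all_analysis.

Set Implicit Arguments.
Unset Strict Implicit.
Unset Printing Implicit Defensive.

Import Order.TTheory GRing.Theory Num.Theory numFieldNormedType.Exports.

Local Open Scope classical_set_scope.
Local Open Scope ring_scope.

(* C^oo on U: every iterated directional derivative of f is Frechet
   differentiable at every point of U.  Only used for U open and V
   finite-dimensional. *)
Definition smooth_on (R : realType) (V W : normedModType R) (U : set V)
    (f : V -> W) : Prop :=
  forall (s : seq V) (x : V), U x ->
    differentiable (foldr (fun v g => 'D_v g) f s) x.

(** * Smooth manifolds *)

Record chart (R : realType) (n : nat) (M : topologicalType) := Chart {
  cdom : set M;
  cmap : M -> 'rV[R]_n;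
  cinv : 'rV[R]_n -> M;
  cdom_open : open cdom;
  cimg_open : open (cmap @` cdom);
  cmap_continuous : forall p, cdom p -> {for p, continuous cmap};
  cinv_continuous : forall x, (cmap @` cdom) x -> {for x, continuous cinv};
  cmapK : forall p, cdom p -> cinv (cmap p) = p }.

Definition cimg (R : realType) n (M : topologicalType) (c : chart R n M) :
  set 'rV[R]_n := cmap c @` cdom c.

Record manifold (R : realType) (n : nat) := Manifold {
  carrier :> topologicalType;
  manifold_hausdorff : hausdorff_space carrier;
  manifold_second_countable : @second_countable carrier;
  chart_index : Type;
  atlas : chart_index -> chart R n carrier;
  atlas_cover : forall p, exists i, cdom (atlas i) p;
  atlas_smooth : forall i j,
    smooth_on (cmap (atlas i) @` (cdom (atlas i) `&` cdom (atlas j)))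
              (cmap (atlas j) \o cinv (atlas i)) }.

(** * The tangent bundle *)

(* A tangent vector at p is a family of components, one for each chart around p,
   related by the differentials of the changes of coordinates.  The components
   in the charts not containing p carry no information and are set to 0. *)
Record tangent (R : realType) (n : nat) (M : manifold R n) := Tangent {
  tbase : M;
  tcomp : chart_index M -> 'rV[R]_n;
  tcomp_out : forall i, ~ cdom (atlas i) tbase -> tcomp i = 0;
  tcomp_law : forall i j, cdom (atlas i) tbase -> cdom (atlas j) tbase ->
    tcomp j = 'd (cmap (atlas j) \o cinv (atlas i))
                 (cmap (atlas i) tbase) (tcomp i) }.

Section TangentChart.
Variables (R : realType) (n : nat) (M : manifold R n).
Implicit Types (i j k : chart_index M) (p : M).

Lemma diff_transition_comp i j k p (v : 'rV[R]_n) :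
  cdom (atlas i) p -> cdom (atlas j) p -> cdom (atlas k) p ->
  'd (cmap (atlas k) \o cinv (atlas i)) (cmap (atlas i) p) v =
  'd (cmap (atlas k) \o cinv (atlas j)) (cmap (atlas j) p)
     ('d (cmap (atlas j) \o cinv (atlas i)) (cmap (atlas i) p) v).
Proof.
move=> pi pj pk.
have dtr a b : cdom (atlas a) p -> cdom (atlas b) p ->
    differentiable (cmap (atlas b) \o cinv (atlas a)) (cmap (atlas a) p).
  by move=> pa pb; apply: (@atlas_smooth _ _ M a b [::]); exists p.
have djk : differentiable (cmap (atlas k) \o cinv (atlas j))
    ((cmap (atlas j) \o cinv (atlas i)) (cmap (atlas i) p)).
  by rewrite /= cmapK//; exact: dtr.
have dij := dtr i j pi pj.
have dc := differentiable_comp dij djk.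
have nj : nbhs (cinv (atlas i) (cmap (atlas i) p)) (cdom (atlas j)).
  by rewrite cmapK//; apply: open_nbhs_nbhs; split => //; exact: cdom_open.
have img : (cmap (atlas i) @` cdom (atlas i)) (cmap (atlas i) p) by exists p.
have eqd : 'D_v (cmap (atlas k) \o cinv (atlas i)) (cmap (atlas i) p) =
    'D_v ((cmap (atlas k) \o cinv (atlas j)) \o
          (cmap (atlas j) \o cinv (atlas i))) (cmap (atlas i) p).
  apply: near_eq_derive.
  have nn : \forall x \near cmap (atlas i) p, cdom (atlas j) (cinv (atlas i) x).
    exact: (cinv_continuous img nj).
  by near do rewrite /= cmapK//.
have e1 := deriveE v (dtr i k pi pk).
have e2 := deriveE v dc.
have e3 : (cmap (atlas j) \o cinv (atlas i)) (cmap (atlas i) p) =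
  cmap (atlas j) p by rewrite /= cmapK.
move: (diff_comp dij djk); rewrite e3 => e4.
exact: etrans (etrans (esym e1) (etrans eqd e2)) (congr1 (@^~ v) e4).
Unshelve. all: by end_near. Qed.

Section TangentOf.
Variables (i : chart_index M) (z : 'rV[R]_n * 'rV[R]_n).

Let p : M := cinv (atlas i) z.1.

Definition tangent_comp j : 'rV[R]_n :=
  if `[< cdom (atlas i) p /\ cdom (atlas j) p >] then
    'd (cmap (atlas j) \o cinv (atlas i)) (cmap (atlas i) p) z.2
  else 0.

Lemma tangent_comp_out j : ~ cdom (atlas j) p -> tangent_comp j = 0.
Proof. by move=> pj; rewrite /tangent_comp; case: asboolP => // -[]. Qed.

Lemma tangent_comp_law j k : cdom (atlas j) p -> cdom (atlas k) p ->
  tangent_comp k = 'd (cmap (atlas k) \o cinv (atlas j))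
                      (cmap (atlas j) p) (tangent_comp j).
Proof.
move=> pj pk; rewrite /tangent_comp.
case: asboolP => [[pi _]|npik]; case: asboolP => [[pi' _]|npij].
- exact: diff_transition_comp.
- by case: npij.
- by case: npik.
- by rewrite linear0.
Qed.

(* The tangent vector with coordinates z = (x, y) in the chart i. *)
Definition tangent_of : tangent M :=
  Tangent tangent_comp_out tangent_comp_law.

End TangentOf.

Definition tcoord i (v : tangent M) : 'rV[R]_n * 'rV[R]_n :=
  (cmap (atlas i) (tbase v), tcomp v i).

(* Coordinate domains, in the chart i, of TM and of T_0 M. *)
Definition TMdom i : set ('rV[R]_n * 'rV[R]_n) :=
  [set z | cimg (atlas i) z.1].
Definition T0dom i : set ('rV[R]_n * 'rV[R]_n) :=
  [set z | cimg (atlas i) z.1 /\ z.2 != 0].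

(* The points of T_0 M, in the chart i, lying over the domain of the chart j. *)
Definition T0overlap i j : set ('rV[R]_n * 'rV[R]_n) :=
  [set z | T0dom i z /\ cdom (atlas j) (cinv (atlas i) z.1)].

Definition ttransition i j : 'rV[R]_n * 'rV[R]_n -> 'rV[R]_n * 'rV[R]_n :=
  tcoord j \o tangent_of i.

Definition is_vector_field
    (X : chart_index M -> 'rV[R]_n * 'rV[R]_n -> 'rV[R]_n * 'rV[R]_n) : Prop :=
  (forall i, smooth_on (T0dom i) (X i)) /\
  (forall i j z, T0overlap i j z ->
    X j (ttransition i j z) = 'd (ttransition i j) z (X i z)).

(* [b i k] is the k-th component of the form in the chart i:
   beta = b_k dx^k. *)
Definition is_semibasic_form
    (b : chart_index M -> 'I_n -> 'rV[R]_n * 'rV[R]_n -> R) : Prop :=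
  (forall i (k : 'I_n), smooth_on (T0dom i) (b i k)) /\
  (forall i j z (u : 'rV[R]_n), T0overlap i j z ->
    \sum_(k < n) b i k z * u 0 k =
    \sum_(k < n) b j k (ttransition i j z) *
           'd (cmap (atlas j) \o cinv (atlas i)) (z.1) u 0 k).

End TangentChart.

(** * Calculus in a chart of the tangent bundle, with coordinates (x, y) *)

Section Local.
Variables (R : realType) (n : nat).
Local Notation TV := ('rV[R]_n * 'rV[R]_n)%type.
Local Notation idx := ('I_n + 'I_n)%type.
Implicit Types (f : TV -> R) (i j k : 'I_n).

Definition dx i f : TV -> R := 'D_((delta_mx 0 i, 0) : TV) f.
Definition dy i f : TV -> R := 'D_((0, delta_mx 0 i) : TV) f.

(* Vector fields and differential forms on the chart are given by their
   components; [inl i] stands for x^i and [inr i] for y^i. *)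
Definition compTM (v : TV) (A : idx) : R :=
  match A with inl i => v.1 0 i | inr i => v.2 0 i end.

Definition extd0 f (A : idx) : TV -> R :=
  match A with inl i => dx i f | inr i => dy i f end.

Definition extd1 (w : idx -> TV -> R) (A B : idx) : TV -> R :=
  fun z => extd0 (w B) A z - extd0 (w A) B z.

Definition inner2 (X : TV -> TV) (w : idx -> idx -> TV -> R) (B : idx) :
  TV -> R := fun z => \sum_A compTM (X z) A * w A B z.

Definition dJ f (A : idx) : TV -> R :=
  match A with inl i => dy i f | inr _ => fun=> 0 end.

Variable G : 'I_n -> TV -> R.

(* S = y^i d/dx^i - 2 G^i d/dy^i *)
Definition spray (z : TV) : TV := (z.2, \row_i (- (2 * G i z))).

Definition spray_deriv f : TV -> R :=
  fun z => \sum_A compTM (spray z) A * extd0 f A z.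

(* [nonlin i j] is N^i_j *)
Definition nonlin i j : TV -> R := dy j (G i).

Definition hderiv i f : TV -> R :=
  fun z => dx i f z - \sum_j nonlin j i z * dy j f z.

(* Vertical-valued semi-basic forms: [L i j] is the component L^i_j of
   L^i_j d/dy^i (x) dx^j, and [K k i j] is the d/dy^k-component of the value of
   a 2-form on (d/dx^i, d/dx^j). *)

Definition jacobi i j : TV -> R :=
  fun z => 2 * hderiv j (G i) z - spray_deriv (nonlin i j) z
           + \sum_k nonlin i k z * nonlin k j z.

Definition tr_jacobi : TV -> R := fun z => \sum_i jacobi i i z.

Definition ricci : TV -> R := fun z => (n%:R - 1)^-1 * tr_jacobi z.

Definition tangent_endo i j : TV -> R := fun=> (i == j)%:R.

Definition tensor_liouville (b : 'I_n -> TV -> R) i j : TV -> R :=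
  fun z => b j z * z.2 0 i.

(* [h, h] / 2; the component on (d/dx^i, d/dx^j) of
   1/2 R^k_ij dx^i /\ dx^j (x) d/dy^k, with R^k_ij antisymmetric, is R^k_ij. *)
Definition curvature k i j : TV -> R :=
  fun z => hderiv j (nonlin k i) z - hderiv i (nonlin k j) z.

Definition wedge_endo (b : 'I_n -> TV -> R) k i j : TV -> R :=
  fun z => b i z * tangent_endo k j z - b j z * tangent_endo k i z.

Definition dh (b : 'I_n -> TV -> R) i j : TV -> R :=
  fun z => hderiv i (b j) z - hderiv j (b i) z.

Definition weyl1 k i j : TV -> R :=
  fun z => curvature k i j z
    - (2 * (n%:R - 1))^-1 *
      wedge_endo (fun l => dJ tr_jacobi (inl l)) k i j z.

End Local.

(** * Finsler geometry *)

Section Finsler.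
Variables (R : realType) (n : nat) (M : manifold R n).
Local Notation TV := ('rV[R]_n * 'rV[R]_n)%type.

Definition metric (f : TV -> R) (z : TV) : 'M[R]_n :=
  \matrix_(i, j) (2^-1 * dy i (dy j (fun w => f w ^+ 2)) z).

Definition lrep (F : tangent M -> R) (i : chart_index M) : TV -> R :=
  F \o tangent_of i.

Record is_finsler (F : tangent M -> R) : Prop := IsFinsler {
  finsler_continuous : forall i z, TMdom i z -> {for z, continuous (lrep F i)};
  finsler_smooth : forall i, smooth_on (T0dom i) (lrep F i);
  finsler_pos : forall i z, T0dom i z -> 0 < lrep F i z;
  finsler_homogeneous : forall i z (l : R), TMdom i z -> 0 < l ->
    lrep F i (z.1, l *: z.2) = l * lrep F i z;
  finsler_regular : forall i z, T0dom i z -> \rank (metric (lrep F i) z) = n }.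

(* [G i k] is the k-th spray coefficient in the chart i; the last condition
   reads i_S d d_J F^2 = - d F^2. *)
Definition is_geodesic_spray (F : tangent M -> R)
    (G : chart_index M -> 'I_n -> TV -> R) : Prop :=
  [/\ forall i k, smooth_on (T0dom i) (G i k),
      @is_vector_field R n M (fun i => spray (G i)) &
      forall i z A, T0dom i z ->
        inner2 (spray (G i)) (extd1 (dJ (fun w => lrep F i w ^+ 2))) A z =
        - extd0 (fun w => lrep F i w ^+ 2) A z].

(* Phi = rho J - alpha (x) C *)
Definition jacobi_decomposition (G a : chart_index M -> 'I_n -> TV -> R) :
    Prop :=
  forall i z k l, T0dom i z ->
    jacobi (G i) k l z =
    ricci (G i) z * tangent_endo k l z - tensor_liouville (a i) k l z.

(* Phi = kappa F^2 J - kappa F d_J F (x) C *)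
Definition constant_flag_curvature (F : tangent M -> R)
    (G : chart_index M -> 'I_n -> TV -> R) : Prop :=
  exists kappa : R, forall i z k l, T0dom i z ->
    jacobi (G i) k l z =
    kappa * lrep F i z ^+ 2 * tangent_endo k l z
    - tensor_liouville
        (fun m w => kappa * lrep F i w * dJ (lrep F i) (inl m) w) k l z.

Definition weyl1_vanishes (G : chart_index M -> 'I_n -> TV -> R) : Prop :=
  forall i z k l m, T0dom i z -> weyl1 (G i) k l m z = 0.

Definition dh_closed (G a : chart_index M -> 'I_n -> TV -> R) : Prop :=
  forall i z k l, T0dom i z -> dh (G i) (a i) k l z = 0.

End Finsler.

(* Main.v *)
From HB Require Import structures.
Require Import Defs.
From mathcomp Require Import all_boot all_order all_algebra.
From mathcomp Require Import all_classical all_reals all_analysis.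
From mathcomp Require Import ring lra.

Set Implicit Arguments.
Unset Strict Implicit.
Unset Printing Implicit Defensive.

Import Order.TTheory GRing.Theory Num.Theory numFieldNormedType.Exports.

Local Open Scope classical_set_scope.
Local Open Scope ring_scope.

(** Write L = F^2, d_i for the horizontal derivative in the direction x^i, and
    a subscript i on a function for its derivative along y^i.

    Metric identities.  Homogeneity of F and regularity of its metric make the
    spray coefficients 2-homogeneous (euler_spray).  With the Euler-Lagrange
    equation this gives S(L) = 0, hence d_i L = 0, hence the symmetry
    d_i L_j = d_j L_i (spray_metric, hderiv_metric, hderiv_dy_metric).  Since
    the curvature is the commutator of the d_i, it annihilates L
    (curvature_metric); since the spray is y^i d_i, contracting it with y gives
    the Jacobi endomorphism (curvature_fiber).

    Dimension two.  A 2-form on a surface has one component, so the last fact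
    and the decomposition of the Jacobi endomorphism give R = alpha /\ J
    (curvature_plane) and rho = Tr Phi = alpha_i y^i.  Hence W_1 = 0 means
    alpha = 1/2 d_J rho (weyl1_plane), and R(L) = 0 means that alpha is
    proportional to d_J L: with K = rho / L the flag curvature,
    alpha = K/2 d_J L (flag_plane).

    If K is constant, then alpha = 1/2 d_J (K L) gives W_1 = 0, and
    d_h alpha = K/2 d_h d_J L vanishes by the symmetry above.

    Conversely, 1/2 d_J (K L) = alpha = K/2 d_J L forces d_J K = 0, so K depends
    on x only.  Then d_h alpha = 1/2 dK /\ d_J L vanishes, i.e.
    K_(x^i) L_j = K_(x^j) L_i; differentiating in y, where dK is constant,
    shows that a combination of two rows of the nondegenerate Hessian of L
    vanishes, so dK = 0 (dx_flag_curvature).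

    Globally, K is constant on each fibre because the punctured plane is
    connected, and it is locally constant along the base.  It does not depend
    on the chart: L is a function on TM, and rho = alpha_i y^i is one because
    alpha is a form.  So K is a locally constant function on the connected
    M.

    The calculus behind this consists of the closure of smooth functions on an
    open set under sums, products and inverses, and of the symmetry of second
    derivatives (derive_comm). *)

(** * Smooth functions on an open set *)

Section SmoothFunctions.
Variables (R : realType) (V : normedModType R) (U : set V).
Hypothesis openU : open U.
Implicit Types (f g : V -> R) (v x : V) (k : nat).

Lemma open_near x : U x -> \forall y \near x, U y.
Proof. by move=> Ux; apply: open_nbhs_nbhs; split. Qed.

(** The differential of f is also that of g: the remainder of g is the one of f
    near the point. *)
Lemma near_eq_differentiable f g x :
  (\forall y \near x, f y = g y) -> differentiable f x -> differentiable g x.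
Proof.
move=> fg df; have fgx : f x = g x by exact: nbhs_singleton fg.
have [dfc dfo] := (diff_locallyP x f).1 df.
have go : g \o shift x = cst (g x) + 'd f x +o_ 0 id.
  apply/eqaddoP => e e0.
  have := (eqaddoP _ _ _ _).1 dfo e e0.
  have fg0 : \forall h \near 0, f (h + x) = g (h + x).
    by move: fg; rewrite (near_shift 0) subr0.
  rewrite -fgx; apply: filter_app; near=> h => /=.
  rewrite -![(_ + _ : _ -> _) _]/(_ + _) -![(- _ : _ -> _) _]/(- _) /=.
  by rewrite (near fg0 h).
apply/diff_locallyP.
by have dgE := diff_unique dfc go; rewrite dgE.
Unshelve. all: by end_near. Qed.

Lemma derive_congr f g v x :
  (forall y, U y -> f y = g y) -> U x -> 'D_v f x = 'D_v g x.
Proof.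
move=> fg Ux; apply: near_eq_derive.
by near=> y; apply: fg; near: y; exact: open_near.
Unshelve. all: by end_near. Qed.

(** Differentiability along all words of at most k directions.  The bound makes
    induction possible for inverses: the derivative of 1/f contains 1/f itself,
    which is then known to one order less. *)
Fixpoint differentiable_upto k f : Prop :=
  (forall x, U x -> differentiable f x) /\
  (if k is k'.+1 then forall v, differentiable_upto k' ('D_v f) else True).

(** Smoothness differentiates along a word from its last letter to its first;
    peeling off the last letter turns words into iterated derivatives. *)
Lemma smooth_onP f : smooth_on U f <-> forall k, differentiable_upto k f.
Proof.
split=> [+ k|].
  elim: k f => [|k IH] f sf; split => //.
  - by move=> x Ux; exact: (sf [::]).
  - by move=> x Ux; exact: (sf [::]).
  - by move=> v; apply: IH => s x Ux; rewrite -foldr_rcons; exact: sf.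
move=> Cf s; elim/last_ind: s f Cf => [|s v IH] f Cf x Ux.
  by have [+ _] := Cf 0%N; exact.
rewrite foldr_rcons; apply: IH => // k.
by have [_ +] := Cf k.+1; exact.
Qed.

Lemma upto_weaken k f : differentiable_upto k.+1 f -> differentiable_upto k f.
Proof.
elim: k f => [|k IH] f [df Df]; split => // v; exact: IH.
Qed.

Lemma upto_congr k f g : (forall x, U x -> f x = g x) ->
  differentiable_upto k f -> differentiable_upto k g.
Proof.
elim: k f g => [|k IH] f g fg [df Df].
  split=> // x Ux; apply: near_eq_differentiable (df x Ux).
  by near=> y; apply: fg; near: y; exact: open_near.
split=> [x Ux|v].
  apply: near_eq_differentiable (df x Ux).
  by near=> y; apply: fg; near: y; exact: open_near.
by apply: IH (Df v) => x Ux; exact: derive_congr.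
Unshelve. all: by end_near. Qed.

Lemma derive_add f g v x : differentiable f x -> differentiable g x ->
  'D_v (fun w => f w + g w) x = 'D_v f x + 'D_v g x.
Proof. by move=> df dg; apply: deriveD; exact: diff_derivable. Qed.

Lemma derive_mul f g v x : differentiable f x -> differentiable g x ->
  'D_v (fun w => f w * g w) x = 'D_v f x * g x + f x * 'D_v g x.
Proof.
move=> df dg; have := @deriveM _ _ f g x v (diff_derivable df) (diff_derivable dg).
by move=> /= ->; rewrite addrC /GRing.scale /= [g x * _]mulrC.
Qed.

Lemma derive_inv f v x : f x != 0 -> differentiable f x ->
  'D_v (fun w => (f w)^-1) x = - ('D_v f x * ((f x)^-1 * (f x)^-1)).
Proof.
move=> f0 df; rewrite deriveV//; last exact: diff_derivable.
by rewrite /GRing.scale /= expr2 invfM mulNr mulrC.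
Qed.

Lemma upto_add k f g : differentiable_upto k f -> differentiable_upto k g ->
  differentiable_upto k (fun w => f w + g w).
Proof.
elim: k f g => [|k IH] f g [df Df] [dg Dg].
  by split=> // x Ux; apply: differentiableD; [exact: df|exact: dg].
split=> [x Ux|v]; first by apply: differentiableD; [exact: df|exact: dg].
apply: upto_congr (IH _ _ (Df v) (Dg v)) => x Ux.
by rewrite derive_add//; [exact: df|exact: dg].
Qed.

Lemma upto_mul k f g : differentiable_upto k f -> differentiable_upto k g ->
  differentiable_upto k (fun w => f w * g w).
Proof.
elim: k f g => [|k IH] f g Cf Cg.
  by case: Cf Cg => df _ [dg _]; split=> // x Ux;
     apply: differentiableM; [exact: df|exact: dg].
have [df Df] := Cf; have [dg Dg] := Cg.
split=> [x Ux|v]; first by apply: differentiableM; [exact: df|exact: dg].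
have h1 := IH _ _ (Df v) (upto_weaken Cg); have h2 := IH _ _ (upto_weaken Cf) (Dg v).
apply: upto_congr (upto_add h1 h2) => x Ux.
by rewrite derive_mul//; [exact: df|exact: dg].
Qed.

Lemma upto_cst k (a : R) : differentiable_upto k (fun=> a).
Proof.
elim: k a => [|k IH] a; split=> //; try by move=> x _; exact: differentiable_cst.
move=> v; apply: upto_congr (IH 0) => x _; by rewrite derive_cst.
Qed.

Lemma upto_inv k f : (forall x, U x -> f x != 0) ->
  differentiable_upto k f -> differentiable_upto k (fun w => (f w)^-1).
Proof.
move=> f0; elim: k => [|k IH] Cf.
  by split=> // x Ux; apply: differentiableV; [case: Cf => + _; exact|exact: f0].
have [df Df] := Cf; have Ci := IH (upto_weaken Cf).
split=> [x Ux|v]; first by apply: differentiableV; [exact: df|exact: f0].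
apply: upto_congr (upto_mul (upto_cst k (-1)) (upto_mul (Df v) (upto_mul Ci Ci))).
by move=> x Ux; rewrite mulN1r derive_inv//; [exact: f0|exact: df].
Qed.

Lemma smooth_differentiable f x : smooth_on U f -> U x -> differentiable f x.
Proof. by move=> sf Ux; exact: (sf [::]). Qed.

Lemma smooth_derive f v : smooth_on U f -> smooth_on U ('D_v f).
Proof. by move=> sf s x Ux; rewrite -foldr_rcons; exact: sf. Qed.

Lemma smooth_cst (a : R) : smooth_on U (fun=> a).
Proof. by apply/smooth_onP => k; exact: upto_cst. Qed.

Lemma smooth_add f g :
  smooth_on U f -> smooth_on U g -> smooth_on U (fun w => f w + g w).
Proof.
move=> /smooth_onP sf /smooth_onP sg; apply/smooth_onP => k.
exact: upto_add.
Qed.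

Lemma smooth_mul f g :
  smooth_on U f -> smooth_on U g -> smooth_on U (fun w => f w * g w).
Proof.
move=> /smooth_onP sf /smooth_onP sg; apply/smooth_onP => k.
exact: upto_mul.
Qed.

Lemma smooth_inv f : (forall x, U x -> f x != 0) ->
  smooth_on U f -> smooth_on U (fun w => (f w)^-1).
Proof. by move=> f0 /smooth_onP sf; apply/smooth_onP => k; exact: upto_inv. Qed.

End SmoothFunctions.

(** * Symmetry of second derivatives *)

Section Lines.
Variables (R : realType) (V : normedModType R).
Implicit Types (f : V -> R) (u v x : V).

Lemma is_derive_line f u x (s : R) : differentiable f (s *: u + x) ->
  is_derive s 1 (fun s => f (s *: u + x)) ('D_u f (s *: u + x)).
Proof.
move=> df.
have E (h : R) : (h *: (1 : R) + s) *: u + x = h *: u + (s *: u + x).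
  by rewrite scalerDl addrA [h *: 1]mulr1.
have EF : (fun h : R => h^-1 *: (((fun s => f (s *: u + x)) \o shift s) (h *: 1)
      - f (s *: u + x))) =
    (fun h => h^-1 *: ((f \o shift (s *: u + x)) (h *: u) - f (s *: u + x))).
  by apply/funext => h /=; rewrite E.
apply: DeriveDef; last by rewrite /derive EF.
by rewrite /derivable EF; exact: diff_derivable.
Qed.

Lemma mean_value_line f u x (t : R) : 0 <= t ->
  (forall s, 0 <= s <= t -> differentiable f (s *: u + x)) ->
  exists2 s, 0 <= s <= t & f (t *: u + x) - f x = 'D_u f (s *: u + x) * t.
Proof.
move=> t0 df.
have [||s st E] := @MVT_segment R (fun s => f (s *: u + x))
    (fun s => 'D_u f (s *: u + x)) 0 t t0.
- move=> s; rewrite in_itv/= => /andP[/ltW s0 /ltW st]; apply: is_derive_line.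
  by apply: df; rewrite s0.
- apply: derivable_within_continuous => s; rewrite in_itv/= => st.
  by have /is_derive_line[] := df s st.
exists s; first by move: st; rewrite in_itv.
by rewrite subr0 scale0r add0r in E.
Qed.

End Lines.

Section Schwarz.
Variables (R : realType) (V : normedModType R) (U : set V).
Hypothesis openU : open U.
Implicit Types (f : V -> R) (u v x : V).

(** Two applications of the mean value theorem: along u to the increment of f in
    the direction v, then along v to the derivative of f in the direction u. *)
Lemma second_difference f u v x (t : R) : smooth_on U f -> 0 <= t ->
  (forall s r, 0 <= s <= t -> 0 <= r <= t -> U (s *: u + (r *: v + x))) ->
  exists s r, [/\ 0 <= s <= t, 0 <= r <= t &
    f (t *: u + (t *: v + x)) - f (t *: u + x) - (f (t *: v + x) - f x) =
    'D_v ('D_u f) (s *: u + (r *: v + x)) * t * t].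
Proof.
move=> sf t0 Ut.
have tt : 0 <= t <= t by rewrite t0 lexx.
have t00 : 0 <= (0 : R) <= t by rewrite t0 lexx.
pose g w := f (w + t *: v) + (- 1) * f w.
have dshift w : U (w + t *: v) -> differentiable (fun w => f (w + t *: v)) w.
  move=> Uw; apply: (@differentiable_comp _ _ _ _ (fun w => w + t *: v) f).
    by apply: differentiableD => //; exact: differentiable_cst.
  exact: smooth_differentiable sf Uw.
have Dshift w : U (w + t *: v) ->
    'D_u (fun w => f (w + t *: v)) w = 'D_u f (w + t *: v).
  move=> Uw; rewrite /derive.
  set F := (fun h => _); set F' := (fun h => _); suff -> : F = F' by [].
  by apply/funext => h; rewrite /F /F' /= addrA.
have Us s : 0 <= s <= t -> U (s *: u + x) /\ U (s *: u + x + t *: v).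
  move=> st; split; first by have := Ut s 0 st t00; rewrite scale0r add0r.
  by have := Ut s t st tt; rewrite [_ *: v + x]addrC addrA.
have df w : U w -> differentiable f w by exact: smooth_differentiable.
have dNf w : U w -> differentiable (fun w => - 1 * f w) w.
  move=> Uw; apply: (@differentiableM _ _ (fun=> - 1) f); last exact: df.
  exact: differentiable_cst.
have [|s st] := @mean_value_line _ _ g u x t t0.
  move=> s /Us[U1 U2]; apply: differentiableD; last exact: dNf.
  exact: dshift.
have [U1 U2] := Us s st.
rewrite /g derive_add//; [|exact: dshift|exact: dNf].
rewrite Dshift// derive_mul//; last exact: df.
rewrite derive_cst mul0r add0r => E1.
have [|r rt E2] := @mean_value_line _ _ ('D_u f) v (s *: u + x) t t0.
  move=> r rt; apply: smooth_differentiable; first exact: smooth_derive sf.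
  by rewrite addrCA; exact: Ut.
exists s, r; split => //.
rewrite [s *: u + (_ + _)]addrCA -E2 [t *: v + (s *: u + x)]addrC.
have -> : t *: u + (t *: v + x) = t *: u + x + t *: v by rewrite -addrA [x + _]addrC.
rewrite [t *: v + x]addrC.
move: E1; rewrite !mulN1r => E1; rewrite -E1; ring.
Qed.

Lemma near_parallelogram (P : set V) u v x : (\forall y \near x, P y) ->
  exists2 t : R, 0 < t & forall s r, 0 <= s <= t -> 0 <= r <= t ->
    P (s *: u + (r *: v + x)).
Proof.
move=> /nbhs_ballP[e /= e0 eP].
have c0 : 0 < `|u| + `|v| + 1 by rewrite ltr_wpDl// addr_ge0.
(* the summand 1 keeps the denominator positive when u = v = 0 *)
exists (e / 2 / (`|u| + `|v| + 1)); first by rewrite !divr_gt0.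
set t := _ / _ => s r /andP[s0 st] /andP[r0 rt].
apply: eP; rewrite -ball_normE /= addrA opprD addrCA subrr addr0 normrN.
apply: (le_lt_trans (ler_normD _ _)); rewrite !normrZ !ger0_norm//.
have tE : t * (`|u| + `|v| + 1) = e / 2 by rewrite /t divfK ?gt_eqF.
have su : s * `|u| <= t * `|u| by rewrite ler_wpM2r.
have rv : r * `|v| <= t * `|v| by rewrite ler_wpM2r.
have t0 : 0 < t by rewrite !divr_gt0.
by lra.
Qed.

(** Both mixed derivatives, taken at points near x, equal the same second
    difference divided by t^2; both are continuous at x. *)
Lemma derive_comm f u v x : smooth_on U f -> U x ->
  'D_u ('D_v f) x = 'D_v ('D_u f) x.
Proof.
move=> sf Ux; apply/eqP; rewrite -subr_eq0 -normr_eq0 eq_le normr_ge0 andbT.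
apply/ler_addgt0Pl => e e0; rewrite addr0.
have e20 : 0 < e / 2 by rewrite divr_gt0.
have cont a b : \forall y \near x, `|'D_a ('D_b f) x - 'D_a ('D_b f) y| < e / 2.
  have := differentiable_continuous (smooth_differentiable
    (smooth_derive a (smooth_derive b sf)) Ux).
  by move=> /cvgrPdist_lt /(_ _ e20).
have := near_parallelogram u v (filterI (open_near openU Ux)
  (filterI (cont u v) (cont v u))).
move=> [t t0 tP].
have [|s1 [r1 [s1t r1t E1]]] := @second_difference f u v x t sf (ltW t0).
  by move=> s r st rt; have [] := tP s r st rt.
have [|s2 [r2 [s2t r2t E2]]] := @second_difference f v u x t sf (ltW t0).
  by move=> s r st rt; have [] := tP r s rt st; rewrite addrCA.
have E : 'D_v ('D_u f) (s1 *: u + (r1 *: v + x)) =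
         'D_u ('D_v f) (r2 *: u + (s2 *: v + x)).
  apply: (mulIf (lt0r_neq0 t0)); apply: (mulIf (lt0r_neq0 t0)).
  rewrite (addrCA (s2 *: v)) (addrCA (t *: v)) in E2.
  apply: etrans (esym E1) (etrans _ E2).
  by rewrite !opprB addrACA [- _ + _]addrC addrACA.
have [_ [_ h1]] := tP _ _ s1t r1t; have [_ [h2 _]] := tP _ _ r2t s2t.
rewrite -E in h2; rewrite [leRHS]splitr.
rewrite -[_ - _](subrKA ('D_v ('D_u f) (s1 *: u + (r1 *: v + x)))).
apply: (le_trans (ler_normD _ _)); apply: lerD; first exact: (ltW h2).
by rewrite distrC; exact: (ltW h1).
Qed.

End Schwarz.

(** * Finite sums, fibre coordinates and directional derivatives *)

Section BigRules.
Variables (R : realType) (V : normedModType R) (U : set V).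
Hypothesis openU : open U.

Lemma smooth_sum (I : Type) (r : seq I) (f : I -> V -> R) :
  (forall i, smooth_on U (f i)) -> smooth_on U (fun w => \sum_(i <- r) f i w).
Proof.
move=> sf; elim: r => [|i r IH].
  by under eq_fun do rewrite big_nil; exact: smooth_cst.
by under eq_fun do rewrite big_cons; exact: smooth_add.
Qed.

Lemma derive_bigsum (I : Type) (r : seq I) (f : I -> V -> R) v x : U x ->
  (forall i, smooth_on U (f i)) ->
  'D_v (fun w => \sum_(i <- r) f i w) x = \sum_(i <- r) 'D_v (f i) x.
Proof.
move=> Ux sf; elim: r => [|i r IH].
  rewrite big_nil (_ : (fun w => _) = cst 0) ?derive_cst//.
  by apply/funext => w; rewrite big_nil.
rewrite big_cons -IH -derive_add.
- by congr ('D_v _ x); apply/funext => w; rewrite big_cons.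
- exact: smooth_differentiable (sf i) Ux.
- exact: smooth_differentiable (smooth_sum r sf) Ux.
Qed.

Lemma smooth_opp (f : V -> R) : smooth_on U f -> smooth_on U (fun w => - f w).
Proof.
move=> sf; rewrite (_ : (fun w => _) = (fun w => -1 * f w)).
  by apply: smooth_mul => //; exact: smooth_cst.
by apply/funext => w; rewrite mulN1r.
Qed.

Lemma derive_opp (f : V -> R) v x : differentiable f x ->
  'D_v (fun w => - f w) x = - 'D_v f x.
Proof. by move=> df; apply: deriveN; exact: diff_derivable. Qed.

Lemma smooth_congr (f g : V -> R) :
  (forall x, U x -> f x = g x) -> smooth_on U f -> smooth_on U g.
Proof.
by move=> fg /smooth_onP sf; apply/smooth_onP => k; exact: upto_congr fg (sf k).
Qed.

End BigRules.

Section ChartCalculus.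
Variables (R : realType) (n : nat).
Local Notation TV := ('rV[R]_n * 'rV[R]_n)%type.
Implicit Types (f g L : TV -> R) (z v w : TV) (i j k : 'I_n).

Definition fiber_coord i : TV -> R := fun w => w.2 0 i.

Lemma fiber_coord_is_linear i : linear (fiber_coord i).
Proof. by move=> a u v; rewrite /fiber_coord /= !mxE. Qed.

HB.instance Definition _ i :=
  GRing.isLinear.Build R TV R _ (fiber_coord i) (fiber_coord_is_linear i).

Lemma differentiable_fiber_coord i z : differentiable (fiber_coord i) z.
Proof.
apply: linear_differentiable => {}z.
apply: (@continuous_comp _ _ _ snd (fun M : 'rV[R]_n => M 0 i)).
  exact: cvg_snd.
exact: coord_continuous.
Qed.

Lemma derive_fiber_coordE v i z : 'D_v (fiber_coord i) z = v.2 0 i.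
Proof.
rewrite deriveE; last exact: differentiable_fiber_coord.
rewrite diff_lin//.
move=> {}z; apply: (@continuous_comp _ _ _ snd (fun M : 'rV[R]_n => M 0 i)).
  exact: cvg_snd.
exact: coord_continuous.
Qed.

Lemma derive_fiber_coord v i : 'D_v (fiber_coord i) = fun=> v.2 0 i.
Proof. by apply/funext => z; exact: derive_fiber_coordE. Qed.

Lemma sum_delta (F : 'I_n -> R) j : \sum_i (i == j)%:R * F i = F j.
Proof.
rewrite (bigD1 j)//= eqxx mul1r big1 ?addr0// => i /negPf ->.
by rewrite mul0r.
Qed.

Lemma derive_linear f z (I : Type) (r : seq I) (c : I -> R) (v : I -> TV) :
  differentiable f z ->
  'D_(\sum_(i <- r) c i *: v i) f z = \sum_(i <- r) c i * 'D_(v i) f z.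
Proof.
move=> df; rewrite deriveE// linear_sum; apply: eq_bigr => i _.
by rewrite linearZ deriveE.
Qed.

Lemma derive_coord v f z : differentiable f z ->
  'D_v f z = \sum_i v.1 0 i * dx i f z + \sum_i v.2 0 i * dy i f z.
Proof.
move=> df; rewrite /dx /dy -!derive_linear// !deriveE// -linearD.
congr ('d f z _); rewrite [LHS]surjective_pairing.
congr (_, _); rewrite !raddf_sum/=.
  rewrite [X in _ = _ + X]big1 ?addr0 -?row_sum_delta// => i _; exact: scaler0.
rewrite [X in _ = X + _]big1 ?add0r -?row_sum_delta// => i _; exact: scaler0.
Qed.

End ChartCalculus.

Local Opaque derive.

(** * Homogeneity along the fibres *)

Section Euler.
Variables (R : realType) (n : nat).
Local Notation TV := ('rV[R]_n * 'rV[R]_n)%type.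
Variable U : set TV.
Hypothesis openU : open U.
Implicit Types (f g L : TV -> R) (z v w : TV) (i j k : 'I_n).

Lemma smooth_fiber_coord i : smooth_on U (@fiber_coord R n i).
Proof.
move=> s z Uz; elim/last_ind: s => [|s v _].
  exact: differentiable_fiber_coord.
by rewrite foldr_rcons derive_fiber_coord; exact: (@smooth_cst _ _ U openU _ s).
Qed.

Lemma smooth_dx i f : smooth_on U f -> smooth_on U (dx i f).
Proof. exact: smooth_derive. Qed.

Lemma smooth_dy i f : smooth_on U f -> smooth_on U (dy i f).
Proof. exact: smooth_derive. Qed.

Lemma big_split2 (a b c d : 'I_n -> R) :
  \sum_i (a i + b i) + \sum_i (c i + d i) =
  (\sum_i a i + \sum_i c i) + (\sum_i b i + \sum_i d i).
Proof. by rewrite !big_split addrACA. Qed.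

(** Leibniz rule for the derivative of f along a variable field X.  The
    Liouville field, the spray and the horizontal fields are all instances, so
    their commutators with coordinate derivatives come from this one identity. *)
Lemma derive_field (X : TV -> TV) f v z : smooth_on U f ->
  (forall i, smooth_on U (fun w => (X w).1 0 i)) ->
  (forall i, smooth_on U (fun w => (X w).2 0 i)) -> U z ->
  'D_v (fun w => 'D_(X w) f w) z = 'D_(X z) ('D_v f) z +
    (\sum_i 'D_v (fun w => (X w).1 0 i) z * dx i f z +
     \sum_i 'D_v (fun w => (X w).2 0 i) z * dy i f z).
Proof.
move=> sf sX1 sX2 Uz.
have s1 i : smooth_on U (fun w => (X w).1 0 i * dx i f w).
  by apply: smooth_mul => //; exact: smooth_dx.
have s2 i : smooth_on U (fun w => (X w).2 0 i * dy i f w).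
  by apply: smooth_mul => //; exact: smooth_dy.
have dsU g : smooth_on U g -> differentiable g z.
  by move=> sg; exact: smooth_differentiable sg Uz.
have E : forall w, U w -> 'D_(X w) f w =
    \sum_i (X w).1 0 i * dx i f w + \sum_i (X w).2 0 i * dy i f w.
  by move=> w Uw; exact/derive_coord/(smooth_differentiable sf).
apply: etrans (derive_congr openU v E Uz) _.
apply: etrans (derive_add v (dsU _ (smooth_sum openU _ s1))
                            (dsU _ (smooth_sum openU _ s2))) _.
apply: etrans (congr2 +%R (derive_bigsum openU _ v Uz s1)
                          (derive_bigsum openU _ v Uz s2)) _.
have e1 i : 'D_v (fun w => (X w).1 0 i * dx i f w) z =
    (X z).1 0 i * dx i ('D_v f) z + 'D_v (fun w => (X w).1 0 i) z * dx i f z.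
  apply: etrans (derive_mul v (dsU _ (sX1 i)) (dsU _ (smooth_dx i sf))) _.
  apply: etrans (addrC _ _) (congr1 (+%R^~ _) (congr1 ( *%R _) _)).
  exact: (derive_comm openU _ _ sf Uz).
have e2 i : 'D_v (fun w => (X w).2 0 i * dy i f w) z =
    (X z).2 0 i * dy i ('D_v f) z + 'D_v (fun w => (X w).2 0 i) z * dy i f z.
  apply: etrans (derive_mul v (dsU _ (sX2 i)) (dsU _ (smooth_dy i sf))) _.
  apply: etrans (addrC _ _) (congr1 (+%R^~ _) (congr1 ( *%R _) _)).
  exact: (derive_comm openU _ _ sf Uz).
apply: etrans (congr2 +%R (eq_bigr _ (fun i _ => e1 i))
                          (eq_bigr _ (fun i _ => e2 i))) _.
apply: etrans (big_split2 _ _ _ _) _.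
by rewrite -(derive_coord (X z) (dsU _ (smooth_derive v sf))).
Qed.

Lemma derive_vertical (u : 'rV[R]_n) f z : differentiable f z ->
  'D_((0, u) : TV) f z = \sum_i u 0 i * dy i f z.
Proof.
move=> df; rewrite derive_coord//= [X in X + _]big1 ?add0r// => i _.
by rewrite mxE mul0r.
Qed.

(** Euler's equation C f = r f.  It is the infinitesimal form of
    r-homogeneity, and the form that derivatives and products preserve. *)
Definition euler (r : R) f :=
  forall z, U z -> 'D_((0, z.2) : TV) f z = r * f z.

Lemma derive_liouville f v z : smooth_on U f -> U z ->
  'D_v (fun w => 'D_((0, w.2) : TV) f w) z =
  'D_((0, z.2) : TV) ('D_v f) z + 'D_((0, v.2) : TV) f z.
Proof.
move=> sf Uz.
rewrite (@derive_field (fun w => (0, w.2)))//; last 2 first.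
- by move=> i /=; exact: smooth_cst.
- exact: smooth_fiber_coord.
congr (_ + _); rewrite [X in X + _]big1 ?add0r; last first.
  by move=> i _; rewrite derive_cst mul0r.
rewrite derive_vertical; last exact: smooth_differentiable sf Uz.
apply: eq_bigr => i _.
exact: (congr1 ( *%R^~ _) (derive_fiber_coordE v i z)).
Qed.

Lemma euler_derive r f v z : smooth_on U f -> euler r f -> U z ->
  'D_((0, z.2) : TV) ('D_v f) z = r * 'D_v f z - 'D_((0, v.2) : TV) f z.
Proof.
move=> sf ef Uz; apply/eqP; rewrite -subr_eq opprK -derive_liouville//.
rewrite (derive_congr (g := fun w => r * f w) openU)// derive_mul.
- by rewrite derive_cst mul0r add0r.
- exact: differentiable_cst.
- exact: smooth_differentiable sf Uz.
Qed.

Lemma euler_dx r f i : smooth_on U f -> euler r f -> euler r (dx i f).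
Proof. by move=> sf ef z Uz; rewrite (euler_derive _ sf ef Uz) derive0 subr0. Qed.

Lemma euler_dy r f i : smooth_on U f -> euler r f -> euler (r - 1) (dy i f).
Proof. by move=> sf ef z Uz; rewrite (euler_derive _ sf ef Uz) mulrBl mul1r. Qed.

Lemma euler_congr r f g : (forall z, U z -> f z = g z) -> euler r f -> euler r g.
Proof.
by move=> fg ef z Uz; rewrite -fg// -ef//; apply: (derive_congr openU) => // w /fg.
Qed.

Lemma euler_mul r s f g : smooth_on U f -> smooth_on U g ->
  euler r f -> euler s g -> euler (r + s) (fun w => f w * g w).
Proof.
move=> sf sg ef eg z Uz; rewrite derive_mul; [|exact: smooth_differentiable Uz..].
by rewrite ef// eg//; ring.
Qed.

Lemma euler_cst (a : R) : euler 0 (fun=> a).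
Proof. by move=> z _; rewrite derive_cst mul0r. Qed.

Lemma euler_scale r (a : R) f : smooth_on U f -> euler r f ->
  euler r (fun w => a * f w).
Proof.
move=> sf ef; rewrite -[r]add0r.
exact: (euler_mul (smooth_cst openU a) sf (@euler_cst a) ef).
Qed.

Lemma euler_fiber_coord i : euler 1 (@fiber_coord R n i).
Proof. by move=> z _; rewrite derive_fiber_coordE mul1r. Qed.

Lemma euler_sum r (I : Type) (s : seq I) (f : I -> TV -> R) :
  (forall a, smooth_on U (f a)) -> (forall a, euler r (f a)) ->
  euler r (fun w => \sum_(a <- s) f a w).
Proof.
move=> sf ef z Uz; rewrite (derive_bigsum openU)// mulr_sumr.
by apply: eq_bigr => a _; exact: ef.
Qed.

Lemma euler_add r f g : smooth_on U f -> smooth_on U g ->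
  euler r f -> euler r g -> euler r (fun w => f w + g w).
Proof.
move=> sf sg ef eg z Uz; rewrite derive_add; [|exact: smooth_differentiable Uz..].
by rewrite ef// eg// mulrDr.
Qed.

End Euler.

(** * Horizontal derivatives and curvature of a spray *)

Section Spray.
Variables (R : realType) (n : nat).
Local Notation TV := ('rV[R]_n * 'rV[R]_n)%type.
Variable U : set TV.
Hypothesis openU : open U.
Variable G : 'I_n -> TV -> R.
Hypothesis smoothG : forall i, smooth_on U (G i).
Implicit Types (f : TV -> R) (z v w : TV) (i j k : 'I_n).

Let differentiableU f z : smooth_on U f -> U z -> differentiable f z.
Proof. exact: smooth_differentiable. Qed.

Lemma smooth_nonlin i j : smooth_on U (nonlin G i j).
Proof. exact: smooth_dy. Qed.

(** The horizontal lift of d/dx^i at z, as a vector: horizontal derivatives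
    become directional derivatives. *)
Definition hvec i z : TV := (delta_mx 0 i, \row_j - nonlin G j i z).

Lemma hderivE i f z : differentiable f z -> hderiv G i f z = 'D_(hvec i z) f z.
Proof.
move=> df; apply: etrans _ (esym (derive_coord (hvec i z) df)).
have e1 : \sum_k (hvec i z).1 0 k * dx k f z = dx i f z.
  by under eq_bigr do rewrite mxE eqxx /=; exact: sum_delta.
have e2 : \sum_k (hvec i z).2 0 k * dy k f z =
    - \sum_k nonlin G k i z * dy k f z.
  by rewrite -sumrN; apply: eq_bigr => k _; rewrite mxE mulNr.
exact: (esym (congr2 +%R e1 e2)).
Qed.

Lemma spray_derivE f z : differentiable f z ->
  spray_deriv G f z = 'D_(spray G z) f z.
Proof. by move=> df; rewrite derive_coord// /spray_deriv big_sumType. Qed.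

Lemma hvec_smooth1 i k : smooth_on U (fun w => (hvec i w).1 0 k).
Proof. exact: smooth_cst. Qed.

Lemma hvec_smooth2 i k : smooth_on U (fun w => (hvec i w).2 0 k).
Proof.
rewrite (_ : (fun w => _) = fun w => - nonlin G k i w).
  exact/smooth_opp/smooth_nonlin.
by apply/funext => w; rewrite mxE.
Qed.

Lemma derive_hderiv v i f z : smooth_on U f -> U z ->
  'D_v (hderiv G i f) z =
  hderiv G i ('D_v f) z - \sum_k 'D_v (nonlin G k i) z * dy k f z.
Proof.
move=> sf Uz.
have E w : U w -> hderiv G i f w = 'D_(hvec i w) f w.
  by move=> Uw; apply: hderivE; exact: differentiableU.
apply: etrans (derive_congr openU v E Uz) _.
apply: etrans (derive_field openU v sf (hvec_smooth1 i) (hvec_smooth2 i) Uz) _.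
rewrite hderivE; last exact: differentiableU (smooth_derive v sf) Uz.
have e1 : \sum_k 'D_v (fun w => (hvec i w).1 0 k) z * dx k f z = 0.
  by apply: big1 => k _; rewrite derive_cst mul0r.
have e2 : \sum_k 'D_v (fun w => (hvec i w).2 0 k) z * dy k f z =
    - \sum_k 'D_v (nonlin G k i) z * dy k f z.
  rewrite -sumrN; apply: eq_bigr => k _.
  apply: etrans (congr1 ( *%R^~ _) _) (mulNr _ _).
  apply: etrans _ (derive_opp v (differentiableU (smooth_nonlin k i) Uz)).
  by apply: (derive_congr openU) => // w _; rewrite mxE.
apply: (congr1 (+%R _)); apply: etrans (congr2 +%R e1 e2) _.
exact: add0r.
Qed.

Lemma smooth_hderiv i f : smooth_on U f -> smooth_on U (hderiv G i f).
Proof.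
move=> sf; apply: (smooth_add openU); first exact: smooth_dx.
apply: (smooth_opp openU); apply: (smooth_sum openU) => j.
by apply: (smooth_mul openU); [exact: smooth_nonlin|exact: smooth_dy].
Qed.

Lemma hderiv_def i f z :
  hderiv G i f z = dx i f z - \sum_k nonlin G k i z * dy k f z.
Proof. by []. Qed.

Local Opaque hderiv.

(** The second derivatives of f along the two lifts commute; what remains is
    the derivative of the connection coefficients. *)
Lemma hderiv_comm i j f z : smooth_on U f -> U z ->
  hderiv G i (hderiv G j f) z - hderiv G j (hderiv G i f) z =
  \sum_k curvature G k i j z * dy k f z.
Proof.
move=> sf Uz.
have dd a b : hderiv G a (hderiv G b f) z =
    'D_(hvec b z) ('D_(hvec a z) f) z -
    \sum_k hderiv G a (nonlin G k b) z * dy k f z.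
  apply: etrans (hderivE a (differentiableU (smooth_hderiv b sf) Uz)) _.
  apply: etrans (derive_hderiv (hvec a z) b sf Uz) _.
  apply: etrans (congr1 (+%R^~ _)
    (hderivE b (differentiableU (smooth_derive (hvec a z) sf) Uz))) _.
  apply: (congr1 (fun t => _ - t)); apply: eq_bigr => k _.
  apply: (congr1 ( *%R^~ _)); apply: esym.
  exact: (hderivE a (differentiableU (smooth_nonlin k b) Uz)).
apply: etrans (congr2 (fun a b => a - b) (dd i j) (dd j i)) _.
apply: etrans (congr1 (fun t => t - _ - _)
  (derive_comm openU (hvec j z) (hvec i z) sf Uz)) _.
have alg (a b c : R) : a - b - (a - c) = c - b by ring.
apply: etrans (alg _ _ _) (etrans (esym (sumrB _ _ _ _)) _).
apply: eq_bigr => k _.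
exact: (esym (mulrBl _ _ _)).
Qed.

Hypothesis eulerG : forall i, euler U 2 (G i).

Lemma nonlin_fiber k z : U z -> \sum_i z.2 0 i * nonlin G k i z = 2 * G k z.
Proof.
by move=> Uz; rewrite -eulerG// derive_vertical//; exact: differentiableU.
Qed.

(** The spray is horizontal, because its coefficients are 2-homogeneous. *)
Lemma spray_hvec z : U z -> spray G z = \sum_i z.2 0 i *: hvec i z.
Proof.
move=> Uz; rewrite [RHS]surjective_pairing !raddf_sum/=.
congr (_, _); first exact: row_sum_delta.
apply/rowP => j; rewrite !mxE summxE -(nonlin_fiber _ Uz) -sumrN.
by apply: eq_bigr => i _; rewrite !mxE mulrN.
Qed.

Lemma spray_hderiv f z : differentiable f z -> U z ->
  \sum_i z.2 0 i * hderiv G i f z = spray_deriv G f z.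
Proof.
move=> df Uz; rewrite spray_derivE// spray_hvec// derive_linear//.
by apply: eq_bigr => i _; rewrite hderivE.
Qed.

(** The identity i_S R = Phi: differentiate y^i N^k_i = 2 G^k horizontally. *)
Lemma curvature_fiber k j z : U z ->
  \sum_i z.2 0 i * curvature G k i j z = jacobi G k j z.
Proof.
move=> Uz.
have h1 : \sum_i z.2 0 i * curvature G k i j z =
    \sum_i z.2 0 i * hderiv G j (nonlin G k i) z - spray_deriv G (nonlin G k j) z.
  apply: etrans (eq_bigr _ (fun i _ => mulrBr _ _ _)) (etrans (sumrB _ _ _ _) _).
  apply: (congr1 (fun t => _ - t)).
  exact: (spray_hderiv (differentiableU (smooth_nonlin k j) Uz) Uz).
have h2 : \sum_i z.2 0 i * hderiv G j (nonlin G k i) z =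
    2 * hderiv G j (G k) z + \sum_i nonlin G k i z * nonlin G i j z.
  have dG := differentiableU (smoothG k) Uz.
  have sD := smooth_derive (hvec j z) (smoothG k).
  have e1 : 'D_(hvec j z) (fun w => 'D_((0, w.2) : TV) (G k) w) z =
      2 * hderiv G j (G k) z.
    apply: etrans (derive_congr openU (hvec j z) (@eulerG k) Uz) _.
    apply: etrans (derive_mul (hvec j z) (differentiable_cst _ _) dG) _.
    by rewrite derive_cst mul0r add0r (hderivE j dG).
  have e2 : 'D_((0, z.2) : TV) ('D_(hvec j z) (G k)) z =
      \sum_i z.2 0 i * hderiv G j (nonlin G k i) z.
    apply: etrans (derive_vertical z.2 (differentiableU sD Uz)) _.
    apply: eq_bigr => i _; apply: (congr1 ( *%R _)).
    apply: etrans (derive_comm openU _ _ (smoothG k) Uz) _.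
    exact: (esym (hderivE j (differentiableU (smooth_nonlin k i) Uz))).
  have e3 : 'D_((0, (hvec j z).2) : TV) (G k) z =
      - \sum_i nonlin G k i z * nonlin G i j z.
    apply: etrans (derive_vertical (hvec j z).2 dG) _.
    rewrite -sumrN; apply: eq_bigr => i _.
    by rewrite mxE mulNr mulrC.
  have := derive_liouville openU (hvec j z) (smoothG k) Uz.
  rewrite e1 e2 e3 => ->; exact: (esym (subrK _ _)).
apply: etrans h1 _; rewrite h2; exact: addrAC.
Qed.

End Spray.

Local Opaque hderiv.

(** * Identities of the energy of a Finsler metric *)

Definition vertically_nondegenerate (R : realType) n
    (U : set ('rV[R]_n * 'rV[R]_n))
    (L : 'rV[R]_n * 'rV[R]_n -> R) : Prop :=
  forall z (u : 'I_n -> R), U z ->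
    (forall j, \sum_i u i * dy i (dy j L) z = 0) -> forall i, u i = 0.

(** The Euler-Lagrange equations S(L_j) = L_(x^j). *)
Definition geodesic (R : realType) n (U : set ('rV[R]_n * 'rV[R]_n))
    (L : 'rV[R]_n * 'rV[R]_n -> R) (G : 'I_n -> 'rV[R]_n * 'rV[R]_n -> R) : Prop :=
  forall j z, U z -> 'D_(spray G z) (dy j L) z = dx j L z.

Record energy_chart (R : realType) n (U : set ('rV[R]_n * 'rV[R]_n))
    (L : 'rV[R]_n * 'rV[R]_n -> R) (G : 'I_n -> 'rV[R]_n * 'rV[R]_n -> R) :
    Prop := EnergyChart {
  chart_open : open U;
  chart_slit : forall z, U z -> z.2 != 0;
  chart_smooth : smooth_on U L;
  chart_smooth_spray : forall i, smooth_on U (G i);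
  chart_positive : forall z, U z -> 0 < L z;
  chart_euler : euler U 2 L;
  chart_nondegenerate : vertically_nondegenerate U L;
  chart_geodesic : geodesic U L G }.

Section Metric.
Variables (R : realType) (n : nat).
Local Notation TV := ('rV[R]_n * 'rV[R]_n)%type.
Variables (U : set TV) (L : TV -> R) (G : 'I_n -> TV -> R).
Hypothesis chartU : energy_chart U L G.
Implicit Types (f : TV -> R) (z v w : TV) (i j k : 'I_n).

Let openU := chart_open chartU.
Let smoothL := chart_smooth chartU.
Let smoothG := chart_smooth_spray chartU.
Let eulerL := chart_euler chartU.
Let nondegenerateL := chart_nondegenerate chartU.
Let geodesicL := chart_geodesic chartU.

Let differentiableU f z : smooth_on U f -> U z -> differentiable f z.
Proof. exact: smooth_differentiable. Qed.

Let smooth_dydyL i j : smooth_on U (dy i (dy j L)).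
Proof. exact/smooth_dy/smooth_dy. Qed.

Let euler_dydyL i j : euler U 0 (dy i (dy j L)).
Proof.
have := euler_dy openU i (smooth_dy j smoothL) (euler_dy openU j smoothL eulerL).
by rewrite (_ : 2 - 1 - 1 = 0)//; ring.
Qed.

(** The Euler-Lagrange equations express G^i L_ij through 2-homogeneous
    functions.  As L_ij is 0-homogeneous and nondegenerate, G^i inherits the
    degree 2. *)
Lemma euler_spray i : euler U 2 (G i).
Proof.
have s2 j : smooth_on U (dy j L) by exact: smooth_dy.
have sxy k j : smooth_on U (dx k (dy j L)) by exact: (smooth_dx k (s2 j)).
have sE j k : smooth_on U (fun w => G k w * dy k (dy j L) w).
  exact: (smooth_mul openU (smoothG k) (smooth_dydyL k j)).
have sf j k : smooth_on U (fun w => fiber_coord k w * dx k (dy j L) w).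
  exact: (smooth_mul openU (smooth_fiber_coord openU k) (sxy k j)).
have ef j k : euler U 2 (fun w => fiber_coord k w * dx k (dy j L) w).
  have e1 := euler_dx openU k (s2 j) (euler_dy openU j smoothL eulerL).
  have := euler_mul (smooth_fiber_coord openU k) (sxy k j)
    (@euler_fiber_coord _ _ U k) e1.
  by rewrite (_ : 1 + (2 - 1) = 2 :> R)//; ring.
have eE j : euler U 2 (fun w => \sum_k G k w * dy k (dy j L) w).
  have sN := smooth_mul openU (smooth_cst openU (- 1)) (smooth_dx j smoothL).
  have eN := euler_scale openU (- 1) (smooth_dx j smoothL)
    (euler_dx openU j smoothL eulerL).
  have sS := smooth_sum openU (index_enum 'I_n) (sf j).
  have eS := euler_sum openU (index_enum 'I_n) (sf j) (ef j).
  have := euler_scale openU 2^-1 (smooth_add openU sS sN) (euler_add sS sN eS eN).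
  apply: (euler_congr openU) => w Uw.
  rewrite -(geodesicL j Uw) (derive_coord _ (differentiableU (s2 j) Uw)).
  rewrite mulN1r opprD addrA subrr add0r -sumrN mulr_sumr.
  by apply: eq_bigr => k _; rewrite mxE; field.
move=> z Uz; apply/eqP; rewrite -subr_eq0; apply/eqP; move: i.
apply: (nondegenerateL Uz) => j.
have eD k : 'D_((0, z.2) : TV) (fun w => G k w * dy k (dy j L) w) z =
    'D_((0, z.2) : TV) (G k) z * dy k (dy j L) z.
  apply: etrans (derive_mul _ (differentiableU (smoothG k) Uz)
                              (differentiableU (smooth_dydyL k j) Uz)) _.
  by rewrite (euler_dydyL k j Uz) mul0r mulr0 addr0.
have := eE j z Uz.
rewrite (derive_bigsum openU _ _ Uz (sE j)) (eq_bigr _ (fun k _ => eD k)).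
rewrite mulr_sumr => /eqP; rewrite -subr_eq0 -sumrB => /eqP E.
apply: etrans E; apply: eq_bigr => k _; by rewrite mulrBl mulrA.
Qed.

(** Contracting the Euler-Lagrange equations with y gives y^j L_(x^j) twice:
    once as it stands, once through Euler's equation; comparing leaves
    S(L) = 0. *)
Lemma spray_metric z : U z -> 'D_(spray G z) L z = 0.
Proof.
have alg (a b c : R) : b = 2 * a - c -> a = b + c -> a = 0.
  by move => *; lra.
move=> Uz; set X := spray G z.
have dL := differentiableU smoothL Uz.
have e1 : 'D_((0, z.2) : TV) ('D_X L) z = \sum_i z.2 0 i * dx i L z.
  apply: etrans (derive_vertical z.2 (differentiableU (smooth_derive X smoothL) Uz)) _.
  apply: eq_bigr => i _; apply: (congr1 ( *%R _)).
  exact: etrans (derive_comm openU _ _ smoothL Uz) (geodesicL i Uz).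
have e2 : 'D_X L z = \sum_i z.2 0 i * dx i L z + 'D_((0, X.2) : TV) L z.
  apply: etrans (derive_coord X dL) (congr1 (+%R _) _).
  exact: (esym (derive_vertical X.2 dL)).
exact: (alg _ _ _ (etrans (esym e1) (euler_derive openU X smoothL eulerL Uz)) e2).
Qed.

(** Differentiating S(L) = 0 along y^i and using the Euler-Lagrange equation
    once gives 2 d_i L. *)
Lemma hderiv_metric i z : U z -> hderiv G i L z = 0.
Proof.
have alg (a b c d e c' : R) :
    a = b + (c' + d) -> a = 0 -> b = c -> c' = c -> d = - (2 * e) -> c - e = 0.
  by move => *; lra.
move=> Uz; have dL := differentiableU smoothL Uz.
have sG2 k : smooth_on U (fun w => (spray G w).2 0 k).
  rewrite (_ : (fun w => _) = fun w => - (2 * G k w)).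
    by apply: (smooth_opp openU); apply: (smooth_mul openU) => //; exact: smooth_cst.
  by apply/funext => w; rewrite mxE.
pose v : TV := (0, delta_mx 0 i).
have E := derive_field (X := spray G) openU v smoothL
  (@smooth_fiber_coord _ _ _ openU) sG2 Uz.
have e0 : 'D_v (fun w => 'D_(spray G w) L w) z = 0.
  exact: (etrans (derive_congr (g := fun=> 0) openU v spray_metric Uz)
                 (derive_cst (0 : R) z v)).
have e1 : \sum_k 'D_v (fun w => (spray G w).1 0 k) z * dx k L z = dx i L z.
  apply: etrans _ (sum_delta (fun k => dx k L z) i); apply: eq_bigr => k _.
  apply: (congr1 ( *%R^~ _)); apply: etrans (derive_fiber_coordE v k z) _.
  by rewrite mxE.
have e2 : \sum_k 'D_v (fun w => (spray G w).2 0 k) z * dy k L z =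
    - (2 * \sum_k nonlin G k i z * dy k L z).
  rewrite mulr_sumr -sumrN; apply: eq_bigr => k _.
  have dG := differentiableU (smoothG k) Uz.
  have dG2 : differentiable (fun w => 2 * G k w) z.
    exact: differentiableU (smooth_mul openU (smooth_cst openU 2) (smoothG k)) Uz.
  have e : 'D_v (fun w => (spray G w).2 0 k) z = - (2 * nonlin G k i z).
    have E' w : U w -> (spray G w).2 0 k = - (2 * G k w) by rewrite mxE.
    apply: etrans (derive_congr openU v E' Uz) _.
    apply: etrans (derive_opp v dG2) (congr1 -%R _).
    apply: etrans (derive_mul v (differentiable_cst _ _) dG) _.
    by rewrite derive_cst mul0r add0r.
  by rewrite e mulNr mulrA.
exact: (alg _ _ _ _ _ _ E e0 (geodesicL i Uz) e1 e2).
Qed.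

(** Differentiating d_i L = 0 along y^j gives d_i L_j = (N^k_i)_j L_k, and
    (N^k_i)_j is a second derivative of G^k. *)
Lemma hderiv_dy_metric i j z : U z ->
  hderiv G i (dy j L) z = hderiv G j (dy i L) z.
Proof.
move=> Uz; have h a b : hderiv G a (dy b L) z =
    \sum_k dy b (nonlin G k a) z * dy k L z.
  pose v : TV := (0, delta_mx 0 b); apply/eqP; rewrite -subr_eq0; apply/eqP.
  have E := derive_hderiv openU smoothG v a smoothL Uz.
  apply: etrans (esym E) _.
  exact: (etrans (derive_congr (g := fun=> 0) openU v (hderiv_metric a) Uz)
                 (derive_cst (0 : R) z v)).
apply: etrans (h i j) (etrans _ (esym (h j i))).
apply: eq_bigr => k _; apply: (congr1 ( *%R^~ _)).
exact: (derive_comm openU _ _ (smoothG k) Uz).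
Qed.

Lemma curvature_metric i j z : U z -> \sum_k curvature G k i j z * dy k L z = 0.
Proof.
move=> Uz; rewrite -(hderiv_comm openU smoothG i j smoothL Uz).
have h a b : hderiv G a (hderiv G b L) z = 0.
  have sb := smooth_hderiv openU smoothG b smoothL.
  apply: etrans (hderivE G a (differentiableU sb Uz)) _.
  exact: (etrans (derive_congr (g := fun=> 0) openU _ (hderiv_metric b) Uz)
                 (derive_cst (0 : R) z _)).
by apply: etrans (congr2 (fun a b => a - b) (h i j) (h j i)) _; exact: subr0.
Qed.

End Metric.

(** * Dimension two *)

Section PlaneAlgebra.
Variable R : realFieldType.

Lemma ord2 (i : 'I_2) : i = 0 \/ i = 1.
Proof. by case: i => -[|[|]]// p; [left|right]; exact: val_inj. Qed.

Lemma sum2 (F : 'I_2 -> R) : \sum_i F i = F 0 + F 1.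
Proof. by rewrite big_ord_recl big_ord1; congr (_ + F _); exact: val_inj. Qed.

Lemma plane_neq0 (y : 'rV[R]_2) : y != 0 -> y 0 0 != 0 \/ y 0 1 != 0.
Proof.
have [y0|] := eqVneq (y 0 0) 0; last by left.
have [y1|] := eqVneq (y 0 1) 0; last by right.
move=> /eqP[]; apply/rowP => i; rewrite mxE.
by have [->|->] := ord2 i.
Qed.

(** The hypotheses are the four components of Phi = (Tr Phi) J - alpha (x) C,
    where c = (c0, c1) is R(d/dx^0, d/dx^1).  They say that each coordinate of
    y annihilates both c0 + a1 and c1 - a0. *)
Lemma isotropic_curvature_plane (y0 y1 c0 c1 a0 a1 : R) :
  y0 != 0 \/ y1 != 0 ->
  - y1 * c0 = (- y1 * c0 + y0 * c1) - a0 * y0 -> y0 * c0 = - (a1 * y0) ->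
  - y1 * c1 = - (a0 * y1) -> y0 * c1 = (- y1 * c0 + y0 * c1) - a1 * y1 ->
  c0 = - a1 /\ c1 = a0.
Proof.
move=> y E00 E01 E10 E11.
have e1 : y0 * (c0 + a1) = 0 by lra.
have e2 : y1 * (c0 + a1) = 0 by lra.
have e3 : y1 * (c1 - a0) = 0 by lra.
have e4 : y0 * (c1 - a0) = 0 by lra.
case: y => y.
  move: e1 e4 => /eqP + /eqP; rewrite !mulf_eq0 (negPf y)/= => /eqP ? /eqP ?.
  by split; lra.
move: e2 e3 => /eqP + /eqP; rewrite !mulf_eq0 (negPf y)/= => /eqP ? /eqP ?.
by split; lra.
Qed.

Lemma wedge_plane (b0 b1 t0 t1 : R) (e f : bool) :
  b0 * e%:R - b1 * f%:R - 2^-1 * (t0 * e%:R - t1 * f%:R) = 0 ->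
  (e -> ~~ f -> 2 * b0 = t0) /\ (~~ e -> f -> 2 * b1 = t1).
Proof. by case: e f => -[] /= E; split=> // _ _; lra. Qed.

Lemma wedge_half (b0 b1 e f : R) :
  b0 * e - b1 * f - 2^-1 * (2 * b0 * e - 2 * b1 * f) = 0.
Proof. by field. Qed.

Lemma flag_plane_algebra (y0 y1 a0 a1 l0 l1 : R) : - a1 * l0 + a0 * l1 = 0 ->
  (y0 * l0 + y1 * l1) * a0 = (a0 * y0 + a1 * y1) * l0 /\
  (y0 * l0 + y1 * l1) * a1 = (a0 * y0 + a1 * y1) * l1.
Proof.
move=> E; split; apply/eqP; rewrite -subr_eq0; apply/eqP.
  by rewrite -[RHS](mulr0 y1) -E; ring.
by rewrite -[RHS](mulr0 (- y0)) -E; ring.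
Qed.

End PlaneAlgebra.

Definition isotropic (R : realType) n (U : set ('rV[R]_n * 'rV[R]_n))
    (G a : 'I_n -> 'rV[R]_n * 'rV[R]_n -> R) : Prop :=
  forall z k l, U z -> jacobi G k l z =
    ricci G z * tangent_endo k l z - tensor_liouville a k l z.

Lemma ricci2 (R : realType) (G : 'I_2 -> 'rV[R]_2 * 'rV[R]_2 -> R) z :
  ricci G z = tr_jacobi G z.
Proof.
have e : 2%:R - 1 = 1 :> R by ring.
by rewrite /ricci e invr1 mul1r.
Qed.

Section Surface.
Variables (R : realType).
Local Notation TV := ('rV[R]_2 * 'rV[R]_2)%type.
Variables (U : set TV) (L : TV -> R) (G a : 'I_2 -> TV -> R).
Hypothesis chartU : energy_chart U L G.
Hypothesis smootha : forall i, smooth_on U (a i).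
Hypothesis isotropicG : isotropic U G a.
Implicit Types (f g : TV -> R) (z v w : TV) (i j k l : 'I_2).

Let openU := chart_open chartU.
Let slitU := chart_slit chartU.
Let smoothL := chart_smooth chartU.
Let smoothG := chart_smooth_spray chartU.
Let eulerL := chart_euler chartU.

Let differentiableU f z : smooth_on U f -> U z -> differentiable f z.
Proof. exact: smooth_differentiable. Qed.

Let eulerG := euler_spray chartU.

Lemma curvature_anti k i j z : curvature G k i j z = - curvature G k j i z.
Proof. exact: (esym (opprB _ _)). Qed.

Lemma curvature_diag k i z : curvature G k i i z = 0.
Proof. exact: subrr. Qed.

Lemma jacobi_plane0 k z : U z ->
  jacobi G k 0 z = - z.2 0 1 * curvature G k 0 1 z.
Proof.
move=> Uz; apply: etrans (esym (curvature_fiber openU smoothG eulerG k 0 Uz)) _.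
apply: etrans (sum2 _) _.
by rewrite curvature_diag (curvature_anti k 1 0) mulr0 add0r mulrN mulNr.
Qed.

Lemma jacobi_plane1 k z : U z -> jacobi G k 1 z = z.2 0 0 * curvature G k 0 1 z.
Proof.
move=> Uz; apply: etrans (esym (curvature_fiber openU smoothG eulerG k 1 Uz)) _.
apply: etrans (sum2 _) _.
by rewrite curvature_diag mulr0 addr0.
Qed.

Lemma tr_jacobi_plane z : U z -> tr_jacobi G z =
  - z.2 0 1 * curvature G 0 0 1 z + z.2 0 0 * curvature G 1 0 1 z.
Proof.
move=> Uz; apply: etrans (sum2 _) _.
exact: (congr2 +%R (jacobi_plane0 0 Uz) (jacobi_plane1 1 Uz)).
Qed.

Lemma curvature_plane01 z : U z ->
  curvature G 0 0 1 z = - a 1 z /\ curvature G 1 0 1 z = a 0 z.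
Proof.
move=> Uz.
have E k l : jacobi G k l z = tr_jacobi G z * (k == l)%:R - a l z * z.2 0 k.
  by apply: etrans (isotropicG k l Uz) _; rewrite ricci2.
have E00 := etrans (esym (jacobi_plane0 0 Uz)) (E 0 0).
have E01 := etrans (esym (jacobi_plane1 0 Uz)) (E 0 1).
have E10 := etrans (esym (jacobi_plane0 1 Uz)) (E 1 0).
have E11 := etrans (esym (jacobi_plane1 1 Uz)) (E 1 1).
rewrite (tr_jacobi_plane Uz) !eqxx /= !mulr1 in E00 E11.
rewrite /= mulr0 add0r in E01; rewrite /= mulr0 add0r in E10.
exact: isotropic_curvature_plane (plane_neq0 (slitU Uz)) E00 E01 E10 E11.
Qed.

Lemma curvature_plane k i j z : U z ->
  curvature G k i j z = wedge_endo a k i j z.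
Proof.
move=> Uz; rewrite /wedge_endo /tangent_endo.
have [c0 c1] := curvature_plane01 Uz.
have c2 := curvature_anti 0 1 0 z; have c3 := curvature_anti 1 1 0 z.
have cc l m : curvature G l m m z = 0 by rewrite /curvature subrr.
have [->|->] := ord2 k; have [->|->] := ord2 i; have [->|->] := ord2 j;
  rewrite ?cc ?c2 ?c3 ?c0 ?c1 ?eqxx /=; ring.
Qed.

(** The contraction rho = alpha_i y^i.  It shows both that the trace is smooth
    and that it does not depend on the chart. *)
Lemma tr_jacobiE z : U z -> tr_jacobi G z = \sum_i a i z * fiber_coord i z.
Proof.
move=> Uz; have [c0 c1] := curvature_plane01 Uz.
by rewrite tr_jacobi_plane// sum2 c0 c1 /fiber_coord; ring.
Qed.

Lemma smooth_tr_jacobi : smooth_on U (tr_jacobi G).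
Proof.
apply: (@smooth_congr _ _ _ openU (fun z => \sum_i a i z * fiber_coord i z)).
  by move=> z Uz; rewrite tr_jacobiE.
apply: (smooth_sum openU) => i.
exact: (smooth_mul openU (smootha i) (smooth_fiber_coord openU i)).
Qed.

(** W_1 is (alpha - 1/2 d_J rho) /\ J, and on a surface b /\ J determines b. *)
Lemma weyl1_plane z : U z ->
  (forall k i j, weyl1 G k i j z = 0) <->
  (forall i, 2 * a i z = dy i (tr_jacobi G) z).
Proof.
move=> Uz.
have E k i j : weyl1 G k i j z = wedge_endo a k i j z -
    2^-1 * wedge_endo (fun l => dy l (tr_jacobi G)) k i j z.
  rewrite /weyl1 curvature_plane// (_ : 2 * (2%:R - 1) = 2 :> R)//; ring.
split=> [W|H k i j].
  have {}W k i j : wedge_endo a k i j z -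
      2^-1 * wedge_endo (fun l => dy l (tr_jacobi G)) k i j z = 0.
    by rewrite -E.
  move=> i; have [->|->] := ord2 i.
    exact: (wedge_plane (W 1 0 1)).1.
  exact: (wedge_plane (W 0 0 1)).2.
apply: etrans (E k i j) _; rewrite /wedge_endo -!H; exact: wedge_half.
Qed.

(** R(L) = 0 reads alpha_0 L_1 = alpha_1 L_0; contraction with y gives the
    factor, by alpha_i y^i = rho and y^i L_i = 2 L. *)
Lemma flag_plane j z : U z -> 2 * L z * a j z = tr_jacobi G z * dy j L z.
Proof.
move=> Uz; have [c0 c1] := curvature_plane01 Uz.
have := curvature_metric chartU 0 1 Uz.
have := eulerL Uz; rewrite derive_vertical; last exact: differentiableU.
rewrite !sum2 c0 c1 tr_jacobiE// sum2 /fiber_coord => <- E.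
have [e0 e1] := flag_plane_algebra (z.2 0 0) (z.2 0 1) E.
have [j0|j1] := ord2 j; first by rewrite j0; exact: e0.
by rewrite j1; exact: e1.
Qed.

End Surface.

Section HderivRules.
Variables (R : realType) (n : nat).
Local Notation TV := ('rV[R]_n * 'rV[R]_n)%type.
Variable U : set TV.
Hypothesis openU : open U.
Variable G : 'I_n -> TV -> R.
Implicit Types (f g : TV -> R) (z : TV) (i : 'I_n).

Lemma hderiv_congr i f g z : smooth_on U f ->
  (forall w, U w -> f w = g w) -> U z -> hderiv G i f z = hderiv G i g z.
Proof.
move=> sf fg Uz; have sg := smooth_congr openU fg sf.
apply: etrans (hderivE G i (smooth_differentiable sf Uz)) _.
apply: etrans (derive_congr openU _ fg Uz) _.
exact: (esym (hderivE G i (smooth_differentiable sg Uz))).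
Qed.

Lemma hderiv_mul i f g z : smooth_on U f -> smooth_on U g -> U z ->
  hderiv G i (fun w => f w * g w) z =
  hderiv G i f z * g z + f z * hderiv G i g z.
Proof.
move=> sf sg Uz.
have df := smooth_differentiable sf Uz; have dg := smooth_differentiable sg Uz.
apply: etrans (hderivE G i (smooth_differentiable (smooth_mul openU sf sg) Uz)) _.
apply: etrans (derive_mul _ df dg) _.
by rewrite (hderivE G i df) (hderivE G i dg).
Qed.

Lemma hderiv_scale i (c : R) g z : smooth_on U g -> U z ->
  hderiv G i (fun w => c * g w) z = c * hderiv G i g z.
Proof.
move=> sg Uz; apply: etrans (hderiv_mul i (smooth_cst openU c) sg Uz) _.
rewrite (hderivE G i (differentiable_cst _ _)) (derive_cst (c : R) z _).
by rewrite mul0r add0r.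
Qed.

End HderivRules.

Section Algebra.
Variable R : realFieldType.

Lemma trace_plane (k L y0 y1 l0 l1 : R) : y0 * l0 + y1 * l1 = 2 * L ->
  (k * L - k / 2 * l0 * y0) + (k * L - k / 2 * l1 * y1) = k * L.
Proof.
move=> E; rewrite (_ : L = (y0 * l0 + y1 * l1) / 2); first by field.
by rewrite E; field.
Qed.

Lemma wedge_scale_eq0 (k x y s : R) :
  2^-1 * (x + k * s) - 2^-1 * (y + k * s) = 0 -> x = y.
Proof. by move=> ?; lra. Qed.

Lemma wedge_cancel (x y a b : R) : x * a = y * b -> y * b + - x * a = 0.
Proof. by move=> E; rewrite mulNr E subrr. Qed.

End Algebra.

Section Surface.
Variables (R : realType).
Local Notation TV := ('rV[R]_2 * 'rV[R]_2)%type.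
Variables (U : set TV) (L : TV -> R) (G a : 'I_2 -> TV -> R).
Hypothesis chartU : energy_chart U L G.
Hypothesis smootha : forall i, smooth_on U (a i).
Hypothesis isotropicG : isotropic U G a.
Implicit Types (f g : TV -> R) (z v w : TV) (i j k l : 'I_2).

Let openU := chart_open chartU.
Let slitU := chart_slit chartU.
Let smoothL := chart_smooth chartU.
Let posL := chart_positive chartU.
Let eulerL := chart_euler chartU.
Let nondegenerateL := chart_nondegenerate chartU.

Let differentiableU f z : smooth_on U f -> U z -> differentiable f z.
Proof. exact: smooth_differentiable. Qed.

Let isotropicE k l z : U z ->
  jacobi G k l z = tr_jacobi G z * (k == l)%:R - a l z * z.2 0 k.
Proof. by move=> Uz; apply: etrans (isotropicG k l Uz) _; rewrite ricci2. Qed.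

(** * Constant flag curvature implies the two conditions *)

Section Constant.
Variable kappa : R.
Hypothesis flat : forall k l z, U z ->
  jacobi G k l z = kappa * L z * (k == l)%:R - kappa / 2 * dy l L z * z.2 0 k.

Lemma constant_trace z : U z -> tr_jacobi G z = kappa * L z.
Proof.
move=> Uz; apply: etrans (sum2 _) _.
apply: etrans (congr2 +%R (flat 0 0 Uz) (flat 1 1 Uz)) _.
rewrite !eqxx !mulr1; apply: trace_plane.
rewrite -(eulerL Uz) (derive_vertical _ (differentiableU smoothL Uz)).
exact: (esym (sum2 _)).
Qed.

Lemma constant_form l z : U z -> a l z = kappa / 2 * dy l L z.
Proof.
move=> Uz; have E k : (a l z - kappa / 2 * dy l L z) * z.2 0 k = 0.
  have := etrans (esym (isotropicE k l Uz)) (flat k l Uz).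
  rewrite (constant_trace Uz) => /addrI/oppr_inj E.
  by rewrite mulrBl E subrr.
apply/eqP; rewrite -subr_eq0.
have [y|y] := plane_neq0 (slitU Uz).
  by have /eqP := E 0; rewrite mulf_eq0 (negPf y) orbF.
by have /eqP := E 1; rewrite mulf_eq0 (negPf y) orbF.
Qed.

Lemma constant_weyl1 k i j z : U z -> weyl1 G k i j z = 0.
Proof.
move=> Uz; move: k i j.
apply/(weyl1_plane chartU isotropicG Uz).
move=> i; rewrite (constant_form i Uz).
have D : dy i (tr_jacobi G) z = kappa * dy i L z.
  apply: etrans (derive_congr openU _ constant_trace Uz) _.
  apply: etrans (derive_mul _ (differentiable_cst kappa z)
    (differentiableU smoothL Uz)) _.
  by rewrite derive_cst mul0r add0r.
by rewrite D [_ / _]mulrC -mulrA mulVKf ?pnatr_eq0.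
Qed.

Lemma constant_dh i j z : U z -> dh G a i j z = 0.
Proof.
move=> Uz.
have h b c : hderiv G b (a c) z = kappa / 2 * hderiv G b (dy c L) z.
  apply: etrans (hderiv_congr openU G b (smootha c) (constant_form c) Uz) _.
  exact: (hderiv_scale openU G b (kappa / 2) (smooth_dy c smoothL) Uz).
apply: etrans (congr2 (fun x y => x - y) (h i j) (h j i)) _.
by rewrite (hderiv_dy_metric chartU i j Uz) subrr.
Qed.

End Constant.

(** * The two conditions imply constant flag curvature in a chart *)

Section Conversely.
Hypothesis weyl : forall k i j z, U z -> weyl1 G k i j z = 0.
Hypothesis closed_form : forall i j z, U z -> dh G a i j z = 0.

Definition flag_curvature : TV -> R := fun w => tr_jacobi G w * (L w)^-1.

Local Notation K := flag_curvature.

Let smooth_tr : smooth_on U (tr_jacobi G).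
Proof.
exact: (smooth_tr_jacobi chartU smootha isotropicG).
Qed.

Lemma metric_neq0 z : U z -> L z != 0.
Proof. by move=> /posL; rewrite lt0r => /andP[]. Qed.

Lemma smooth_flag_curvature : smooth_on U K.
Proof. exact: (smooth_mul openU smooth_tr (smooth_inv openU metric_neq0 smoothL)). Qed.

Lemma flag_curvature_tr z : U z -> tr_jacobi G z = K z * L z.
Proof. by move=> /metric_neq0 L0; rewrite /flag_curvature mulfVK. Qed.

Lemma flag_curvature_form i z : U z -> a i z = 2^-1 * (K z * dy i L z).
Proof.
move=> Uz; have L0 := metric_neq0 Uz.
have := flag_plane chartU isotropicG i Uz.
rewrite (flag_curvature_tr Uz) => E.
have L20 : 2 * L z != 0 by rewrite mulf_neq0// pnatr_eq0.
by apply: (mulfI L20); rewrite E; field.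
Qed.

(** Vanishing of W_1 gives 2 alpha = d_J (K L), while 2 alpha = K d_J L always
    holds. *)
Lemma dy_flag_curvature i z : U z -> dy i K z = 0.
Proof.
move=> Uz; have L0 := metric_neq0 Uz.
have W := (weyl1_plane chartU isotropicG Uz).1 (fun k l m => weyl k l m Uz) i.
have D : dy i (tr_jacobi G) z = dy i K z * L z + K z * dy i L z.
  apply: etrans (derive_congr openU _ flag_curvature_tr Uz) _.
  exact: (derive_mul _ (differentiableU smooth_flag_curvature Uz)
                       (differentiableU smoothL Uz)).
have := etrans W D; rewrite (flag_curvature_form i Uz) mulVKf ?pnatr_eq0//.
rewrite addrC -[X in X = _]addr0 => /addrI /esym/eqP.
by rewrite mulf_eq0 (negPf L0) orbF => /eqP.
Qed.

Lemma hderiv_flag_curvature i z : U z -> hderiv G i K z = dx i K z.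
Proof.
move=> Uz; apply: etrans (hderiv_def _ _ _ _) _.
by rewrite sum2 !(dy_flag_curvature _ Uz) !mulr0 addr0 subr0.
Qed.

(** In d_h (K/2 d_J L) the terms with horizontal derivatives of d_J L cancel. *)
Lemma dx_flag_curvature_wedge i j z : U z ->
  dx i K z * dy j L z = dx j K z * dy i L z.
Proof.
move=> Uz; have sK := smooth_flag_curvature.
have h b c : hderiv G b (a c) z =
    2^-1 * (dx b K z * dy c L z + K z * hderiv G b (dy c L) z).
  apply: etrans (hderiv_congr openU G b (smootha c) (flag_curvature_form c) Uz) _.
  have sc := smooth_dy c smoothL.
  apply: etrans (hderiv_scale openU G b 2^-1 (smooth_mul openU sK sc) Uz) _.
  apply: (congr1 ( *%R _)); apply: etrans (hderiv_mul openU G b sK sc Uz) _.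
  by rewrite (hderiv_flag_curvature b Uz).
have := etrans (esym (congr2 (fun x y => x - y) (h i j) (h j i))) (closed_form i j Uz).
rewrite (hderiv_dy_metric chartU i j Uz).
exact: wedge_scale_eq0.
Qed.

(** Differentiating K_(x^0) L_1 = K_(x^1) L_0 along y^m puts the vector
    (K_(x^1), - K_(x^0)) in the kernel of the Hessian of L. *)
Lemma dx_flag_curvature i z : U z -> dx i K z = 0.
Proof.
move=> Uz; have sK := smooth_flag_curvature.
have dK k m w : U w -> dy m (dx k K) w = 0.
  move=> Uw; apply: etrans (derive_comm openU _ _ sK Uw) _.
  apply: etrans (derive_congr (g := fun=> 0) openU _ (dy_flag_curvature m) Uw) _.
  exact: (derive_cst (0 : R) w _).
have D k l m : dy m (fun w => dx k K w * dy l L w) z = dx k K z * dy l (dy m L) z.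
  apply: etrans (derive_mul _ (differentiableU (smooth_dx k sK) Uz)
    (differentiableU (smooth_dy l smoothL) Uz)) _.
  apply: etrans (congr2 (fun x y => x * _ + _ * y) (dK k m z Uz)
    (derive_comm openU _ _ smoothL Uz)) _.
  by rewrite mul0r add0r.
pose u i : R := if i == 0 then dx 1 K z else - dx 0 K z.
have u0 : forall i, u i = 0.
  apply: (nondegenerateL Uz) => m; apply: etrans (sum2 _) _.
  have E := derive_congr openU (0, delta_mx 0 m) (dx_flag_curvature_wedge 0 1) Uz.
  have := etrans (esym (D 0 1 m)) (etrans E (D 1 0 m)).
  exact: wedge_cancel.
have [->|->] := ord2 i; first by have /eqP := u0 1; rewrite /u /= oppr_eq0 => /eqP.
exact: (u0 0).
Qed.

Lemma derive_flag_curvature v z : U z -> 'D_v K z = 0.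
Proof.
move=> Uz.
apply: etrans (derive_coord v (differentiableU smooth_flag_curvature Uz)) _.
have e1 : \sum_i v.1 0 i * dx i K z = 0.
  by apply: big1 => i _; rewrite (dx_flag_curvature i Uz) mulr0.
have e2 : \sum_i v.2 0 i * dy i K z = 0.
  by apply: big1 => i _; rewrite (dy_flag_curvature i Uz) mulr0.
exact: (etrans (congr2 +%R e1 e2) (addr0 _)).
Qed.

Lemma jacobi_flag_curvature k l z : U z ->
  jacobi G k l z = K z * L z * (k == l)%:R - K z / 2 * dy l L z * z.2 0 k.
Proof.
move=> Uz; rewrite (isotropicE k l Uz) (flag_curvature_tr Uz).
by rewrite (flag_curvature_form l Uz) mulrA [_^-1 * _]mulrC.
Qed.

End Conversely.

End Surface.

(** * The energy of a Finsler function in a chart *)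

Lemma euler_lagrange_algebra (R : realFieldType) (s t d : R) :
  s - 2 * d + t = - d -> s + t = d.
Proof. by move=> ?; lra. Qed.

Section FinslerChart.
Variables (R : realType) (n : nat) (M : manifold R n).
Local Notation TV := ('rV[R]_n * 'rV[R]_n)%type.
Variables (F : tangent M -> R) (hF : is_finsler F).
Variable (i : chart_index M).
Implicit Types (z : TV) (k l : 'I_n).

Definition energy : TV -> R := fun w => lrep F i w ^+ 2.

Local Notation U := (T0dom (M := M) i).
Local Notation L := energy.

Lemma open_T0dom : open U.
Proof.
rewrite (_ : U = fst @^-1` cimg (atlas i) `&`
    (fun z : TV => `|z.2|) @^-1` [set x | 0 < x]).
  apply: openI; apply: open_comp.
  - by move=> z _; exact: cvg_fst.
  - exact: cimg_open.
  - move=> z _; apply: (@continuous_comp _ _ _ snd); first exact: cvg_snd.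
    exact: norm_continuous.
  - exact: open_gt.
by apply/seteqP; split=> z [z1 z2]; split=> //; move: z2; rewrite /= normr_gt0.
Qed.

Let smooth_lrep : smooth_on U (lrep F i).
Proof. by apply: (@finsler_smooth _ _ _ _ hF). Qed.

Lemma smooth_energy : smooth_on U L.
Proof.
apply: (smooth_congr open_T0dom _ (smooth_mul open_T0dom smooth_lrep smooth_lrep)).
by move=> w _; rewrite /energy expr2.
Qed.

Lemma energy_gt0 z : U z -> 0 < L z.
Proof. by move=> /(finsler_pos hF) Fz; rewrite exprn_gt0. Qed.

Lemma dy_energy k z : U z -> dy k L z = 2 * lrep F i z * dy k (lrep F i) z.
Proof.
move=> Uz; have dF := smooth_differentiable smooth_lrep Uz.
have E w : U w -> L w = lrep F i w * lrep F i w by move=> _; rewrite /energy expr2.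
apply: etrans (derive_congr open_T0dom _ E Uz) _.
apply: etrans (derive_mul _ dF dF) _.
have alg (a b : R) : a * b + b * a = 2 * b * a by ring.
exact: alg.
Qed.

Lemma derive_square (c : R) : 'D_1 (fun s : R => (s + 1) * ((s + 1) * c)) 0 = 2 * c.
Proof.
have d1 : differentiable (fun s : R => s + 1) (0 : R).
  by apply: differentiableD => //; exact: differentiable_cst.
have d2 : differentiable (fun s : R => (s + 1) * c) (0 : R).
  by apply: differentiableM => //; exact: differentiable_cst.
have D1 : 'D_1 (fun s : R => s + 1) 0 = 1.
  apply: etrans (derive_add _ _ (differentiable_cst (1 : R) _)) _ => //.
  by rewrite derive_id derive_cst addr0.
rewrite (derive_mul _ d1 d2) (derive_mul _ d1 (differentiable_cst c _)) D1.
by rewrite derive_cst /=; ring.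
Qed.

(** The energy at z + s (0, y) is (s + 1)^2 L z; the derivative at s = 0 is
    computed in both ways. *)
Lemma euler_energy : euler U 2 L.
Proof.
move=> z Uz; set v : TV := (0, z.2).
have dL := smooth_differentiable smooth_energy Uz.
have E0 : 0 *: v + z = z by rewrite scale0r add0r.
have H : is_derive (0 : R) 1 (fun s => L (s *: v + z)) ('D_v L z).
  by have := @is_derive_line _ _ L v z 0; rewrite E0; apply.
rewrite -(@derive_val _ _ _ _ _ _ _ H) -(derive_square (L z)).
apply: near_eq_derive; near=> s.
have s0 : 0 < s + 1.
  rewrite -ltrBlDr sub0r; near: s; exact: lt_nbhsr.
have Mz : TMdom i z by case: Uz.
have -> : s *: v + z = (z.1, (s + 1) *: z.2).
  rewrite [LHS]surjective_pairing /= scaler0 add0r.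
  by congr (_, _); rewrite scalerDl scale1r.
rewrite /energy (finsler_homogeneous hF Mz s0); ring.
Unshelve. all: by end_near. Qed.

Lemma nondegenerate_energy : vertically_nondegenerate U L.
Proof.
move=> z u Uz H k; pose r : 'rV[R]_n := \row_j u j.
suff r0 : r = 0 by have := congr1 (fun A : 'rV[R]_n => A 0 k) r0; rewrite !mxE.
have free : row_free (metric (lrep F i) z).
  by rewrite /row_free (finsler_regular hF Uz).
apply/eqP; rewrite -(mulmx_free_eq0 _ free); apply/eqP/rowP => j.
rewrite !mxE; apply: etrans _ (etrans (congr1 ( *%R 2^-1) (H j)) (mulr0 _)).
by rewrite mulr_sumr; apply: eq_bigr => l _; rewrite !mxE mulrCA.
Qed.

Variable G : chart_index M -> 'I_n -> TV -> R.
Hypothesis hG : is_geodesic_spray F G.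

Lemma smooth_spray_coef k : smooth_on U (G i k).
Proof. by case: hG => sG _ _; exact: sG. Qed.

Lemma geodesic_energy : geodesic U L (G i).
Proof.
move=> j z Uz; have [_ _ EL] := hG.
have sj := smooth_dy j smooth_energy.
have {EL} := EL i z (inl j) Uz.
rewrite /inner2 big_sumType /=.
have e1 : \sum_k z.2 0 k * (dx k (dy j L) z - dx j (dy k L) z) =
    \sum_k z.2 0 k * dx k (dy j L) z - 2 * dx j L z.
  apply: etrans (eq_bigr _ (fun k _ => mulrBr _ _ _)) (etrans (sumrB _ _ _ _) _).
  apply: (congr1 (fun t => _ - t)).
  have sx := smooth_dx j smooth_energy.
  apply: etrans _ (euler_dx open_T0dom j smooth_energy euler_energy Uz).
  apply: etrans _ (esym (derive_vertical _ (smooth_differentiable sx Uz))).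
  apply: eq_bigr => k _; apply: (congr1 ( *%R _)).
  exact: (derive_comm open_T0dom _ _ smooth_energy Uz).
have e2 : \sum_k (spray (G i) z).2 0 k * (dy k (dy j L) z - dx j (fun=> 0) z) =
    \sum_k (spray (G i) z).2 0 k * dy k (dy j L) z.
  apply: eq_bigr => k _; apply: (congr1 ( *%R _)).
  by apply: etrans (congr1 (fun t => _ - t) (derive_cst (0 : R) z _)) (subr0 _).
move=> EL; apply: etrans (derive_coord _ (smooth_differentiable sj Uz)) _.
apply: euler_lagrange_algebra; apply: etrans _ EL.
exact: (esym (congr2 +%R e1 e2)).
Qed.

Lemma energy_chart_T0dom : energy_chart U L (G i).
Proof.
split.
- exact: open_T0dom.
- by move=> z [].
- exact: smooth_energy.
- exact: smooth_spray_coef.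
- exact: energy_gt0.
- exact: euler_energy.
- exact: nondegenerate_energy.
- exact: geodesic_energy.
Qed.

End FinslerChart.

(** * Functions with vanishing differential *)

Lemma derive0_segment (R : realType) (V : normedModType R) (U : set V)
    (f : V -> R) (x v : V) :
  (forall z, U z -> differentiable f z) -> (forall z w, U z -> 'D_w f z = 0) ->
  (forall s, 0 <= s <= 1 -> U (s *: v + x)) -> f (v + x) = f x.
Proof.
move=> df Df Uv.
have [s s01] := mean_value_line ler01 (fun s s01 => df _ (Uv s s01)).
by rewrite (Df _ _ (Uv s s01)) mul0r scale1r => /eqP; rewrite subr_eq0 => /eqP.
Qed.

Lemma connected_locally_constant (T : topologicalType) (X : Type) (f : T -> X) :
  connected [set: T] -> (forall p, \forall q \near p, f q = f p) ->
  forall p q, f p = f q.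
Proof.
move=> cT lc p q.
suff : [set r | f r = f p] = setT by move=> /seteqP[_ /(_ q I) /= ->].
apply: cT; first by exists p.
- exists [set r | f r = f p]; last by rewrite setTI.
  rewrite openE => r /= rp; rewrite /interior; near=> s => /=.
  by rewrite -rp; near: s; exact: lc.
- exists [set r | f r = f p]; last by rewrite setTI.
  rewrite -[X in closed X]setCK; apply: open_closedC; rewrite openE => r /= rp.
  rewrite /interior; near=> s => /= sp; apply: rp; rewrite -sp; apply: esym.
  by near: s; exact: lc.
Unshelve. all: by end_near. Qed.

Section SlitPlane.
Variable R : realType.
Implicit Types y : 'rV[R]_2.

Definition det2 y y' : R := y 0 0 * y' 0 1 - y 0 1 * y' 0 0.

(** A third point for joining y to a negative multiple of y away from 0. *)
Definition quarter_turn y : 'rV[R]_2 := \row_k (if k == 0 then - y 0 1 else y 0 0).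

Lemma segment_avoids_origin y y' (s : R) : det2 y y' != 0 ->
  s *: (y' - y) + y != 0.
Proof.
move=> d0; apply/eqP => E.
have c k : s * (y' 0 k - y 0 k) + y 0 k = 0.
  by have := congr1 (fun A : 'rV[R]_2 => A 0 k) E; rewrite !mxE.
have e0 := c 0; have e1 := c 1.
have sd : s * det2 y y' = 0.
  rewrite /det2 (_ : _ * _ = y 0 0 * (s * (y' 0 1 - y 0 1) + y 0 1) -
    y 0 1 * (s * (y' 0 0 - y 0 0) + y 0 0)); last by ring.
  by rewrite e0 e1 !mulr0 subrr.
have s0 : s = 0 by move/eqP: sd; rewrite mulf_eq0 (negPf d0) orbF => /eqP.
move: d0; rewrite s0 !mul0r !add0r in e0 e1.
by rewrite /det2 e0 e1 !mul0r subrr eqxx.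
Qed.

(** By Lagrange's identity |y|^2 |y'|^2 is the sum of the squares of the two
    determinants det(y, y') and det(Jy, y'), which cannot both vanish. *)
Lemma det2_quarter_turn y y' : y != 0 -> y' != 0 -> det2 y y' = 0 ->
  det2 y (quarter_turn y) != 0 /\ det2 (quarter_turn y) y' != 0.
Proof.
move=> y0 y'0 d; rewrite /det2 !mxE /=.
have pos (w : 'rV[R]_2) : w != 0 -> 0 < w 0 0 ^+ 2 + w 0 1 ^+ 2.
  move=> /plane_neq0[w0|w0]; first by rewrite ltr_wpDr ?sqr_ge0// exprn_even_gt0.
  by rewrite ltr_wpDl ?sqr_ge0// exprn_even_gt0.
have p := pos _ y0; have p' := pos _ y'0.
split; first by apply: lt0r_neq0; move: p; rewrite !expr2; lra.
apply/eqP => e; move: (mulr_gt0 p p').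
have -> : (y 0 0 ^+ 2 + y 0 1 ^+ 2) * (y' 0 0 ^+ 2 + y' 0 1 ^+ 2) =
    (det2 y y') ^+ 2 + (- y 0 1 * y' 0 1 - y 0 0 * y' 0 0) ^+ 2.
  by rewrite /det2; ring.
by rewrite d e expr0n /= addr0 ltxx.
Qed.

End SlitPlane.

Section ChartConstant.
Variables (R : realType) (M : manifold R 2) (i : chart_index M).
Local Notation TV := ('rV[R]_2 * 'rV[R]_2)%type.
Variable K : TV -> R.
Hypothesis dK : forall z, T0dom i z -> differentiable K z.
Hypothesis DK : forall z v, T0dom i z -> 'D_v K z = 0.
Implicit Types (x y : 'rV[R]_2).

Lemma fiber_segment x y y' : cimg (atlas i) x -> det2 y y' != 0 ->
  K (x, y') = K (x, y).
Proof.
move=> xi d; have := @derive0_segment _ _ _ K (x, y) (0, y' - y) dK DK.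
have -> : (0, y' - y) + (x, y) = (x, y') :> TV.
  by rewrite [LHS]surjective_pairing /= add0r subrK.
apply => s _; split; rewrite /= ?scaler0 ?add0r//.
exact: segment_avoids_origin.
Qed.

(** The punctured plane is connected by at most two segments. *)
Lemma fiber_constant x y y' : cimg (atlas i) x -> y != 0 -> y' != 0 ->
  K (x, y') = K (x, y).
Proof.
move=> xi y0 y'0; have [d|] := eqVneq (det2 y y') 0; last exact: fiber_segment.
have [d1 d2] := det2_quarter_turn y0 y'0 d.
by rewrite (fiber_segment xi d2) (fiber_segment xi d1).
Qed.

Lemma base_locally_constant x y : cimg (atlas i) x -> y != 0 ->
  \forall x' \near x, K (x', y) = K (x, y).
Proof.
move=> xi y0.
have : nbhs x (cimg (atlas i)) by apply: open_nbhs_nbhs; split=> //; exact: cimg_open.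
move=> /nbhs_ballP[e /= e0 eU]; apply/nbhs_ballP; exists e => //= x' xx'.
have := @derive0_segment _ _ _ K (x, y) (x' - x, 0) dK DK.
have -> : (x' - x, 0) + (x, y) = (x', y) :> TV.
  by rewrite [LHS]surjective_pairing /= add0r subrK.
apply => s /andP[s0 s1]; split; rewrite /= ?scaler0 ?add0r//.
apply: eU; move: xx'; rewrite -!ball_normE /= opprD addrCA subrr addr0 normrN normrZ.
rewrite ger0_norm// distrC => xx'; apply: le_lt_trans xx'.
by rewrite ler_piMl.
Qed.

End ChartConstant.

(** * Changes of chart and the global argument *)

Section ChangeOfChart.
Variables (R : realType) (n : nat) (M : manifold R n).
Local Notation TV := ('rV[R]_n * 'rV[R]_n)%type.
Implicit Types (z : TV) (i j k : chart_index M) (p : M).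

Lemma tangent_ext (v w : tangent M) :
  tbase v = tbase w -> tcomp v = tcomp w -> v = w.
Proof.
case: v w => p c o l [p' c' o' l'] /= pp cc; subst p' c'.
by congr Tangent; exact: Prop_irrelevance.
Qed.

Lemma cimg_cinv i x : cimg (atlas i) x ->
  cdom (atlas i) (cinv (atlas i) x) /\ cmap (atlas i) (cinv (atlas i) x) = x.
Proof. by move=> [p pi <-]; rewrite cmapK. Qed.

Lemma T0overlap_dom i j z : T0overlap i j z ->
  [/\ T0dom i z, cdom (atlas i) (cinv (atlas i) z.1) &
      cdom (atlas j) (cinv (atlas i) z.1)].
Proof.
move=> [[/= /cimg_cinv[zi E] z0] zj]; split=> //; split=> //.
by exists (cinv (atlas i) z.1).
Qed.

Lemma tangent_compE i j z : cdom (atlas i) (cinv (atlas i) z.1) ->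
  cdom (atlas j) (cinv (atlas i) z.1) -> tangent_comp i z j =
  'd (cmap (atlas j) \o cinv (atlas i)) (cmap (atlas i) (cinv (atlas i) z.1)) z.2.
Proof. by move=> zi zj; rewrite /tangent_comp asboolT. Qed.

Lemma ttransitionE i j z : T0overlap i j z -> ttransition i j z =
  (cmap (atlas j) (cinv (atlas i) z.1),
   'd (cmap (atlas j) \o cinv (atlas i)) (z.1) z.2).
Proof.
move=> ov; have [_ zi zj] := T0overlap_dom ov.
have [_ E] := cimg_cinv ov.1.1.
have e := tangent_compE zi zj; rewrite E in e.
exact: (congr1 (pair _) e).
Qed.

(** The components in a third chart agree by the chain rule for changes of
    coordinates. *)
Lemma tangent_of_ttransition i j z : T0overlap i j z ->
  tangent_of j (ttransition i j z) = tangent_of i z.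
Proof.
move=> ov; have [_ zi zj] := T0overlap_dom ov.
have pE : cinv (atlas j) (ttransition i j z).1 = cinv (atlas i) z.1 by exact: cmapK.
have z'2 : (ttransition i j z).2 = 'd (cmap (atlas j) \o cinv (atlas i))
    (cmap (atlas i) (cinv (atlas i) z.1)) z.2 by exact: tangent_compE.
apply: tangent_ext; first exact: pE.
apply/funext => k; have [zk|nk] := pselect (cdom (atlas k) (cinv (atlas i) z.1)).
  have e := tangent_compE (z := ttransition i j z) (i := j) (j := k).
  rewrite pE z'2 in e; apply: etrans (e zj zk) (esym _).
  apply: etrans (tangent_compE zi zk) _.
  exact: (diff_transition_comp _ zi zj zk).
apply: etrans (tangent_comp_out _) (esym (tangent_comp_out nk)).
by rewrite pE.
Qed.

End ChangeOfChart.

Section FinslerSurface.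
Variables (R : realType) (M : manifold R 2).
Local Notation TV := ('rV[R]_2 * 'rV[R]_2)%type.
Variables (F : tangent M -> R) (G alpha : chart_index M -> 'I_2 -> TV -> R).
Hypothesis hF : is_finsler F.
Hypothesis hG : is_geodesic_spray F G.
Hypothesis halpha : is_semibasic_form alpha.
Hypothesis hdec : jacobi_decomposition G alpha.
Implicit Types (z : TV) (i j : chart_index M).

Let smooth_alpha i k : smooth_on (T0dom i) (alpha i k).
Proof. by case: halpha => sa _; exact: sa. Qed.

Let isotropicG i : isotropic (T0dom i) (G i) (alpha i).
Proof. by move=> z k l Uz; exact: hdec. Qed.

Let chartU i : energy_chart (T0dom i) (energy F i) (G i).
Proof. exact: energy_chart_T0dom. Qed.

Lemma constant_flag_curvature_weyl1_dh : constant_flag_curvature F G ->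
  weyl1_vanishes G /\ dh_closed G alpha.
Proof.
move=> [kappa flat].
have flatL i k l z : T0dom i z -> jacobi (G i) k l z =
    kappa * energy F i z * (k == l)%:R -
    kappa / 2 * dy l (energy F i) z * z.2 0 k.
  move=> Uz; apply: etrans (flat i z k l Uz) _.
  apply: (congr1 (fun t => _ - t)); rewrite /tensor_liouville /= (dy_energy hF l Uz).
  have alg (a b c : R) : kappa * a * b * c = kappa / 2 * (2 * a * b) * c by field.
  exact: alg.
split=> i z k l => [m|] Uz.
  exact: (constant_weyl1 (chartU i) (@isotropicG i) (flatL i) _ _ _ Uz).
exact: (constant_dh (chartU i) (@smooth_alpha i) (@isotropicG i) (flatL i) _ _ Uz).
Qed.

Section Conversely.
Hypothesis connectedM : connected [set: M].
Hypothesis weylG : weyl1_vanishes G.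
Hypothesis closed_alpha : dh_closed G alpha.

Let K i := flag_curvature (energy F i) (G i).

Let differentiableK i z : T0dom i z -> differentiable (K i) z.
Proof.
move=> Uz; apply: (smooth_differentiable _ Uz).
exact: (smooth_flag_curvature (chartU i) (@smooth_alpha i) (@isotropicG i)).
Qed.

Let deriveK i z v : T0dom i z -> 'D_v (K i) z = 0.
Proof.
move=> Uz.
apply: (derive_flag_curvature (chartU i) (@smooth_alpha i) (@isotropicG i)) Uz.
- by move=> k l m w Uw; exact: weylG.
- by move=> k l w Uw; exact: closed_alpha.
Qed.

Lemma energy_ttransition i j z : T0overlap i j z ->
  energy F j (ttransition i j z) = energy F i z.
Proof. by move=> ov; rewrite /energy /lrep /= tangent_of_ttransition. Qed.

(** The new fibre component is not 0, because F vanishes on the zero section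
    and nowhere else. *)
Lemma T0dom_ttransition i j z : T0overlap i j z -> T0dom j (ttransition i j z).
Proof.
move=> ov; have [Uz zi zj] := T0overlap_dom ov.
have T1 : cimg (atlas j) (ttransition i j z).1.
  by rewrite ttransitionE//=; exists (cinv (atlas i) z.1).
split=> //; apply/eqP => z20.
have E := energy_ttransition ov; have := chart_positive (chartU i) Uz; rewrite -E /energy.
(* F(x, 2 0) = 2 F(x, 0) forces F(x, 0) = 0 *)
have := finsler_homogeneous hF T1 (ltr0n R 2).
rewrite [_ *: _](_ : _ = (ttransition i j z).2); last by rewrite z20 scaler0.
rewrite -surjective_pairing => H.
have -> : lrep F j (ttransition i j z) = 0 by lra.
by rewrite expr0n ltxx.
Qed.

(** The transformation law of alpha, evaluated on the vector y. *)
Lemma tr_jacobi_ttransition i j z : T0overlap i j z ->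
  tr_jacobi (G j) (ttransition i j z) = tr_jacobi (G i) z.
Proof.
move=> ov; have [Uz _ _] := T0overlap_dom ov; have Uz' := T0dom_ttransition ov.
have trE k w : T0dom k w ->
    tr_jacobi (G k) w = \sum_l alpha k l w * fiber_coord l w.
  exact: (tr_jacobiE (chartU k) (@isotropicG k)).
rewrite (trE j _ Uz') (trE i _ Uz); have [_ law] := halpha.
apply: etrans _ (esym (law i j z z.2 ov)); apply: eq_bigr => l _.
by rewrite /fiber_coord {2}(ttransitionE ov).
Qed.

Let K_ttransition i j z : T0overlap i j z -> K j (ttransition i j z) = K i z.
Proof.
move=> ov; rewrite /K /flag_curvature tr_jacobi_ttransition//.
by rewrite energy_ttransition.
Qed.

Let e0 : 'rV[R]_2 := delta_mx 0 0.

Let e0_neq0 : e0 != 0.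
Proof. by apply/eqP => /matrixP /(_ 0 0); rewrite !mxE/= => /eqP; rewrite oner_eq0. Qed.

(** The chart around p and the direction e0 are arbitrary choices; that the
    value is independent of them is point_curvatureE. *)
Let point_curvature (p : M) : R :=
  K (sval (cid (@atlas_cover _ _ M p)))
    (cmap (atlas (sval (cid (@atlas_cover _ _ M p)))) p, e0).

Let point_curvatureE i p y : cdom (atlas i) p -> y != 0 ->
  K i (cmap (atlas i) p, y) = point_curvature p.
Proof.
move=> pi y0; rewrite /point_curvature.
case: (cid _) => j pj /=; set z : TV := (cmap (atlas i) p, y).
have Uz : T0dom i z by split=> //; exists p.
have ov : T0overlap i j z by split=> //=; rewrite cmapK.
rewrite -(K_ttransition ov); have [_ z'0] := T0dom_ttransition ov.
have -> : ttransition i j z = (cmap (atlas j) p, (ttransition i j z).2).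
  by rewrite {1}(ttransitionE ov) (ttransitionE ov) /= cmapK.
apply: (fiber_constant (@differentiableK j) (@deriveK j)) => //.
by exists p.
Qed.

Let point_curvature_constant p q : point_curvature p = point_curvature q.
Proof.
apply: (connected_locally_constant connectedM) => {q}{}p.
have [i pi] := @atlas_cover _ _ M p.
have pU : cimg (atlas i) (cmap (atlas i) p) by exists p.
have h := base_locally_constant (@differentiableK i) (@deriveK i) pU e0_neq0.
have pn : \forall q \near p, cdom (atlas i) q.
  by apply: open_nbhs_nbhs; split=> //; exact: cdom_open.
have hK : \forall q \near p,
    K i (cmap (atlas i) q, e0) = K i (cmap (atlas i) p, e0).
  exact: (cmap_continuous pi h).
apply: filterS (filterI hK pn) => q [E qi].
by rewrite -(point_curvatureE pi e0_neq0) -E (point_curvatureE qi e0_neq0).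
Qed.

Lemma weyl1_dh_constant_flag_curvature : constant_flag_curvature F G.
Proof.
have [kappa Kk] : exists kappa, forall i z, T0dom i z -> K i z = kappa.
  (* on an empty manifold any constant will do *)
  have [[p _]|M0] := pselect (exists p : M, True); last first.
    by exists 0 => i z [[p _ _] _]; case: M0; exists p.
  exists (point_curvature p) => i [x y] [[q qi /= qE] /= y0].
  by rewrite -qE (point_curvatureE qi y0); exact: point_curvature_constant.
exists kappa => i z k l Uz; rewrite -(Kk i z Uz).
apply: etrans (jacobi_flag_curvature (chartU i) (@isotropicG i) k l Uz) _.
rewrite -/(K i) (dy_energy hF l Uz) /tensor_liouville /tangent_endo /=.
apply: (congr1 (fun t => _ - t)).
have alg (c a b d : R) : c / 2 * (2 * a * b) * d = c * a * b * d by field.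
exact: alg.
Qed.

End Conversely.

End FinslerSurface.

Theorem theorem3p2 (R : realType) (M : manifold R 2)
    (hconn : connected [set: M])
    (F : tangent M -> R) (hF : is_finsler F)
    (G : chart_index M -> 'I_2 -> 'rV[R]_2 * 'rV[R]_2 -> R)
    (hG : is_geodesic_spray F G)
    (alpha : chart_index M -> 'I_2 -> 'rV[R]_2 * 'rV[R]_2 -> R)
    (halpha : is_semibasic_form alpha)
    (hdec : jacobi_decomposition G alpha) :
  constant_flag_curvature F G <-> weyl1_vanishes G /\ dh_closed G alpha.
Proof.
split; first exact: constant_flag_curvature_weyl1_dh.
by move=> [W D]; exact: (weyl1_dh_constant_flag_curvature hF hG halpha hdec).
Qed.
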